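(* There are absolute constants $c>0$ and $K_0$ such that the following holds: for every real $K\ge K_0$ and every finite multiset $A$ of positive integers satisfying $\mathcal R(A)>K$, $$\varepsilon(A)\le \exp\bigl(-c\sqrt{K\log K}\bigr).$$
   Context: For a finite multiset $A$ of positive integers, $\mathcal R(A):=\sum_{a\in A}\frac1a$ (counted with multiplicity), and $$\varepsilon(A):=1-\max\{\mathcal R(S):S\subseteq A,\ \mathcal R(S)\le 1\},$$ where $S\subseteq A$ means that $S$ is a submultiset of $A$ (multiplicities bounded by those of $A$; the empty submultiset, with $\mathcal R=0$, is allowed). *)

(* Defs.v *)
From mathcomp Require Import all_boot all_order all_algebra.
From mathcomp Require Import finmap multiset.
From mathcomp Require Import boolp classical_sets cardinality reals.

Set Implicit Arguments.
Unset Strict Implicit.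
Unset Printing Implicit Defensive.

Import Order.TTheory GRing.Theory Num.Theory.

Local Open Scope classical_set_scope.
Local Open Scope ring_scope.

(* The sum runs over [enum_mset A], so terms are repeated according to their
   multiplicity. *)
Definition recip_sum (R : realType) (A : {mset nat}%mset) : R :=
  \sum_(a <- A) a%:R^-1.

Definition recip_subsums (R : realType) (A : {mset nat}%mset) : set R :=
  [set recip_sum R S | S in
    [set S : {mset nat}%mset | (S `<=` A)%mset /\ recip_sum R S <= 1]].

Arguments recip_subsums : clear implicits.

(* The set of subsums is finite and nonempty, so its [sup] is a maximum:
   see [recip_defect_max] below. *)
Definition recip_defect (R : realType) (A : {mset nat}%mset) : R :=
  1 - sup (recip_subsums R A).

Lemma recip_subsums0 (R : realType) (A : {mset nat}%mset) :
  recip_subsums R A 0.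
Proof.
have s0 : recip_sum R mset0 = 0 by rewrite /recip_sum enum_mset0 big_nil.
by exists mset0 => //=; rewrite s0 ler01 msub0set.
Qed.

Lemma finite_recip_subsums (R : realType) (A : {mset nat}%mset) :
  finite_set (recip_subsums R A).
Proof.
pose f (m : (size A).-tuple bool) : R := \sum_(a <- mask m A) a%:R^-1.
apply: (@sub_finite_set _ _ (f @` setT)); last first.
  exact/finite_image/finite_finset.
move=> _ [S [/msubsetP SA _] <-].
have /count_subseqP[s /subseqP[m sm ->] Sm] x :
  (count_mem x S <= count_mem x A)%N by rewrite !count_mem_mset.
by exists (tcast sm (in_tuple m)) => //; rewrite /f val_tcast -(perm_big _ Sm).
Qed.

Lemma recip_defect_max (R : realType) (A : {mset nat}%mset) :
  exists S : {mset nat}%mset,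
    [/\ (S `<=` A)%mset, recip_sum R S <= 1,
        recip_defect R A = 1 - recip_sum R S &
        forall T : {mset nat}%mset, (T `<=` A)%mset -> recip_sum R T <= 1 ->
          recip_sum R T <= recip_sum R S].
Proof.
have ubA : ubound (recip_subsums R A) 1 by move=> _ [S [_ ?] <-].
have supA : has_sup (recip_subsums R A).
  by split; [exists 0; exact: recip_subsums0 | exists 1].
have [S [SA S1] SE] : recip_subsums R A (sup (recip_subsums R A)).
  have /finite_seqP[s sE] := finite_recip_subsums R A.
  have s0 : 0 \in s by have := recip_subsums0 R A; rewrite sE.
  pose M := \big[Num.max/0]_(x <- s) x.
  have Ms : M \in s.
    rewrite /M big_seq; elim/big_ind: _ => // x y xs ys.
    by rewrite /Num.max; case: ifP.
  have -> : sup (recip_subsums R A) = M.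
    apply/eqP; rewrite eq_le; apply/andP; split.
      apply: ge_sup; first by case: supA.
      by rewrite sE => x /= xs; exact: le_bigmax_seq xs _.
    by apply: sup_upper_bound => //; rewrite sE.
  by rewrite sE.
exists S; split=> // [|T TA T1]; first by rewrite /recip_defect -SE.
by rewrite SE; apply: sup_upper_bound => //; exists T.
Qed.

(* Main.v *)
Require Import Defs.
From mathcomp Require Import all_boot all_order all_algebra.
From mathcomp Require Import finmap multiset.
From mathcomp Require Import reals sequences exp.
From mathcomp Require Import topology normedtype derive trigo.
From mathcomp Require Import zify ring lra.

Import Order.TTheory GRing.Theory Num.Theory numFieldNormedType.Exports.
Local Open Scope ring_scope.

Set Implicit Arguments.
Unset Strict Implicit.
Unset Printing Implicit Defensive.

(** Why the theorem holds.  Let N be about 2 exp (c sqrt (K log K)) and put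
    L = log N, so that K is a large multiple of L^2 / log L.  It is enough to
    find a submultiset whose reciprocal sum lies in [1 - 2/N, 1].  Call the
    reciprocal sum of a multiset its mass.

    Merging.  If a occurs at least p times, p its least prime factor, then p
    copies of a can be replaced by one copy of a / p: the mass is unchanged and
    every subsum of the new multiset is a subsum of the old one.  At the end
    either 1 occurs, and we are done, or every a occurs fewer times than its
    least prime factor ([merge_copies]).

    Coarse and fine scales.  Let X0 be the largest integer such that the elements
    that are at least X0 have mass at least 1.  Chosen greedily, these reach any
    target in [0, 1] up to an error 1 / X0, which finishes the proof if
    N <= X0.  Otherwise the elements below X0 have mass more than K - 2, and they
    are used for a fine adjustment.  From them we extract gadgets, numbers
    x = n / a coming from 2 n copies of a, so that x can be used up to twice;
    the gadgets x_1, x_2, ... have sum s at most 1/8.  Testing the distribution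
    of the sums of gadgets against the Fejer kernel of degree D = 2 N^2 shows that
    some sum is within 1/N of any prescribed u with |u - s| <= 1 / X0, as
    soon as the sum over X0/4 <= h < D of prod_i cos^2 (pi h x_i) is at most 1/4
    ([double_sums_hit]).  Frequencies h < X0/4 do no harm: at distance 1 / X0
    from s they enter with a nonnegative coefficient.

    Selecting the gadgets.  They are chosen one after the other, each new gadget
    x multiplying the above sum of products by at most 1 - kappa x, with kappa
    of order log N; gadgets of total size 1/16 are then enough
    ([select_gadgets]).  A gadget as good as that exists by averaging over the
    gadgets 2^i / a ([good_gadget]), and this requires a lower bound for one
    frequency h at a time: all a contribute their fair share except those having
    a multiple very close to h ([sum_gadget_gain]).

    The arithmetic point is that such a have small mass, O(L^2 / log L), for every
    h.  If a = q b is composite with least prime factor q, the multiple of a next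
    to h is also the multiple of b next to h, hence it is determined by b; so q
    is one of the few large primes that divide a number determined by b.  As a
    occurs fewer than q times, its mass is below 1/b, and the sum over b is
    harmonic ([composite_mass_le]).  Primes are counted by their distance to h
    instead ([prime_mass_le]).  Elements with fewer than M copies, M of order L,
    are discarded: apart from multiples of small primes, which have few copies
    anyway, they are free of small prime factors and therefore sparse; so they have
    mass O(M L / log L) ([small_mass_le], [rough_sum_harmonic]).  All losses are
    O(L^2 / log L), which is what K exceeds. *)

(** * A lower bound for the sine *)

Lemma cos_piquarter_ge (R : realType) : 1 / 2 <= cos (pi / 4 : R) /\ 1 / 2 <= sin (pi / 4 : R).
Proof.
have e : (pi / 4 : R) *+ 2 = pi / 2 by rewrite -mulr_natr; field.
have h := cos_mulr2n (pi / 4 : R); rewrite e cos_pihalf in h.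
have pg := pi_ge2 R; have c0 : 0 < cos (pi / 4 : R).
  by apply: cos_gt0_pihalf; apply/andP; split; lra.
have s0 : 0 < sin (pi / 4 : R) by apply: sin_gt0_pihalf; apply/andP; split; lra.
have h2 := cos2Dsin2 (pi / 4 : R).
by split; nra.
Qed.

Lemma sin_pi_ge (R : realType) (x : R) : 0 <= x <= 1 / 2 -> x <= sin (pi * x).
Proof.
move=> /andP[x0 x1]; have pg := pi_ge2 R.
have [c4 s4] := cos_piquarter_ge R.
have [xs|xs] := lerP x (1 / 4); last first.
  apply: (@le_trans _ _ (1 / 2)) => //; apply: le_trans s4 _.
  rewrite ltW // ltr_sin ?in_itv /=; [nra | |]; apply/andP; split; nra.
have [x00|xn0] := eqVneq x 0; first by rewrite x00 mulr0 sin0.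
have {xn0}x0 : 0 < x by rewrite lt_neqAle eq_sym xn0.
have px0 : 0 < pi * x by nra.
have cs := @continuous_sin R.
have [y] := MVT px0 (fun y _ => is_derive_sin y) (continuous_subspaceT cs).
rewrite in_itv /= => /andP[y0 y1]; rewrite sin0 !subr0 => ->.
suff : 1 / 2 <= cos y by nra.
apply: le_trans c4 _; rewrite ltW // ltr_cos ?in_itv /=; [nra | |]; apply/andP; split; nra.
Qed.

(** * Sums of gadgets and the Fejer kernel *)

(** The square of the modulus of sum_(j < D) exp (2 i pi j x), that is, D times the
    Fejer kernel, written with cosines only. *)
Definition fejer (R : realType) (D : nat) (x : R) : R :=
  \sum_(0 <= i < D) \sum_(0 <= j < D) cos (2 * pi * (i%:R - j%:R) * x).

(** The two geometric sums telescope after multiplication by [2 * sin (pi * x)];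
    the sum of the squares of the results is [2 - 2 * cos (2 * D * pi * x)]. *)
Lemma fejer_le (R : realType) (D : nat) (x : R) :
  sin (pi * x) ^+ 2 * fejer D x <= 1.
Proof.
pose C := \sum_(0 <= i < D) cos (2 * pi * i%:R * x).
pose S := \sum_(0 <= i < D) sin (2 * pi * i%:R * x).
have -> : fejer D x = C ^+ 2 + S ^+ 2.
  rewrite /fejer !expr2 /C /S !big_distrlr -big_split /=.
  apply: eq_bigr => i _; rewrite -big_split /=; apply: eq_bigr => j _.
  by rewrite -cosB; congr cos; ring.
set y := pi * x.
have hC : 2 * sin y * C = sin (2 * D%:R * y - y) + sin y.
  rewrite /C; elim: D {C S} => [|D IH].
    by rewrite big_nil mulr0 mulr0 mul0r sub0r sinN addNr.
  rewrite big_nat_recr //= mulrDr IH.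
  have -> : 2 * D.+1%:R * y - y = 2 * D%:R * y + y by rewrite -natr1; ring.
  have -> : 2 * pi * D%:R * x = 2 * D%:R * y by rewrite /y; ring.
  by rewrite sinB sinD; ring.
have hS : 2 * sin y * S = cos y - cos (2 * D%:R * y - y).
  rewrite /S; elim: D {C S hC} => [|D IH].
    by rewrite big_nil mulr0 mulr0 mul0r sub0r cosN subrr.
  rewrite big_nat_recr //= mulrDr IH.
  have -> : 2 * D.+1%:R * y - y = 2 * D%:R * y + y by rewrite -natr1; ring.
  have -> : 2 * pi * D%:R * x = 2 * D%:R * y by rewrite /y; ring.
  by rewrite cosB cosD; ring.
set B := 2 * D%:R * y - y in hC hS.
have e : 4 * (sin y ^+ 2 * (C ^+ 2 + S ^+ 2)) =
  (cos y ^+ 2 + sin y ^+ 2) + (cos B ^+ 2 + sin B ^+ 2) - 2 * cos (B + y).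
  transitivity ((2 * sin y * C) ^+ 2 + (2 * sin y * S) ^+ 2); first by ring.
  by rewrite hC hS (cosD B y); ring.
rewrite !cos2Dsin2 in e; have := cos_geN1 (B + y); lra.
Qed.

(** All sums in which each entry is used 0, 1, 1 or 2 times.  The two ways of using
    it once turn the average of a cosine into a square [cos ^+ 2], so that the
    Fourier coefficients of this distribution are nonnegative. *)
Fixpoint double_sums (R : realType) (xs : seq R) : seq R :=
  if xs is x :: xs' then
    let s := double_sums xs' in
    s ++ [seq x + z | z <- s] ++ [seq x + z | z <- s] ++ [seq x + x + z | z <- s]
  else [:: 0].

Lemma size_double_sums (R : realType) (xs : seq R) :
  size (double_sums xs) = (4 ^ size xs)%N.
Proof.
elim: xs => //= x xs IH; rewrite !size_cat !size_map IH expnS; lia.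
Qed.

Lemma sum_cos_double_sums (R : realType) (xs : seq R) (t b : R) :
  \sum_(z <- double_sums xs) cos (b + t * z) =
  (4 ^ size xs)%:R * (\prod_(x <- xs) cos (t * x / 2) ^+ 2) *
  cos (b + t * \sum_(x <- xs) x).
Proof.
elim: xs b => [|x xs IH] b /=.
  by rewrite big_seq1 !big_nil expn0 !mul1r.
have shift w : \sum_(z <- double_sums xs) cos (b + t * (w + z)) =
    \sum_(z <- double_sums xs) cos (b + t * w + t * z).
  by apply: eq_bigr => z _; rewrite mulrDr addrA.
rewrite !big_cat !big_map /= !shift.
rewrite !IH !big_cons expnS natrM; set P := \prod_(j <- xs) _; set s := \sum_(j <- xs) j.
set c := (4 ^ _)%:R; rewrite (_ : b + t * (x + s) = (b + t * x + t * s)); last by ring.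
set B := b + t * x + t * s.
have -> : b + t * s = B - 2 * (t * x / 2) by rewrite /B; field.
have -> : b + t * (x + x) + t * s = B + 2 * (t * x / 2) by rewrite /B; field.
set d := t * x / 2; rewrite cosB cosD mulr_natl cos_mulr2n sin_mulr2n; ring.
Qed.

Definition cos_weight (R : realType) (xs : seq R) (h : nat) : R :=
  \prod_(x <- xs) cos (pi * h%:R * x) ^+ 2.

Lemma cos_weight_ge0 (R : realType) (xs : seq R) (h : nat) : 0 <= cos_weight xs h.
Proof. by apply: prodr_ge0 => x _; exact: sqr_ge0. Qed.

Lemma sum_dist_le (R : realType) (g : nat -> R) (D i : nat) :
  (forall h, 0 <= g h) -> g 0%N = 0 -> (i < D)%N ->
  \sum_(0 <= j < D) g ((i - j) + (j - i))%N <= 2 * \sum_(0 <= h < D) g h.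
Proof.
move=> g0 g00 iD.
have mono k : (k <= D)%N -> \sum_(0 <= h < k) g h <= \sum_(0 <= h < D) g h.
  by move=> kD; rewrite (big_cat_nat _ kD) //= lerDl sumr_ge0.
have -> : \sum_(0 <= j < D) g ((i - j) + (j - i))%N =
  \sum_(0 <= j < i.+1) g (i - j)%N + \sum_(i.+1 <= j < D) g (j - i)%N.
  rewrite (big_cat_nat _ iD) //=; congr (_ + _); apply: eq_big_nat => j /andP[h1 h2].
    by congr g; lia.
  by congr g; lia.
rewrite mulr_natl mulr2n; apply: lerD.
  rewrite big_nat_rev /= add0n.
  rewrite (eq_big_nat _ _ (F2 := g)); first exact: mono.
  by move=> j /andP[_ h]; congr g; lia.
have -> : \sum_(i.+1 <= j < D) g (j - i)%N = \sum_(i <= j < D) g (j - i)%N.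
  by rewrite [RHS]big_ltn // subnn g00 add0r.
rewrite -{1}[i]add0n big_addn (eq_big_nat _ _ (F2 := g)).
  by apply: mono; lia.
by move=> j _; rewrite addnK.
Qed.

(** Averaging the kernel centred at [u] over [double_sums xs] gives the sum over
    i, j < D of [cos_weight xs] at i - j times cos (2 pi (i - j) (s - u)), where s
    is the sum of [xs].  The diagonal contributes [D], the terms with
    |i - j| < [Y] are nonnegative because their phase is at most pi / 2, and the
    others cost at most [D / 2].  So the average is at least [D / 2], which [fejer_le]
    forbids if all the sums are far from [u] modulo 1. *)
Lemma double_sums_hit (R : realType) (xs : seq R) (u : R) (D Y : nat) :
  (0 < D)%N -> (0 < Y)%N ->
  \sum_(0 <= h < D | (Y <= h)%N) cos_weight xs h <= 1 / 4 ->
  4 * Y%:R * `|\sum_(x <- xs) x - u| <= 1 ->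
  exists2 z, z \in double_sums xs & sin (pi * (z - u)) ^+ 2 <= 2 / D%:R.
Proof.
move=> D0 Y0 hW hu.
have D0' : 0 < D%:R :> R by rewrite ltr0n.
case: (boolP (has (fun z => sin (pi * (z - u)) ^+ 2 <= 2 / D%:R) (double_sums xs))).
  by move=> /hasP[z zs hz]; exists z.
move=> /hasPn hn; exfalso.
set n := size xs; set c : R := (4 ^ n)%:R; have c0 : 0 < c by rewrite ltr0n expn_gt0.
have hup : \sum_(z <- double_sums xs) fejer D (z - u) < c * (D%:R / 2).
  have -> : c * (D%:R / 2) = \sum_(z <- double_sums xs) (D%:R / 2).
    by rewrite big_const_seq count_predT iter_addr_0 size_double_sums -[RHS]mulr_natl.
  have ne : double_sums xs != [::].
    by rewrite -size_eq0 size_double_sums -lt0n expn_gt0.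
  have lt z : z \in double_sums xs -> fejer D (z - u) < D%:R / 2.
    move=> zs; have := hn z zs; rewrite -ltNge => h.
    have hf := fejer_le D (z - u).
    have h2 : 0 < 2 / D%:R :> R by rewrite divr_gt0.
    have e : D%:R / 2 = (2 / D%:R)^-1 :> R by field; rewrite gt_eqF.
    rewrite e -div1r ltr_pdivlMr //.
    have [neg|pos] := lerP (fejer D (z - u)) 0.
      by apply: (@le_lt_trans _ _ 0) => //; rewrite mulr_le0_ge0 // ltW.
    apply: lt_le_trans hf; rewrite mulrC ltr_pM2r //.
  case: (double_sums xs) ne lt => // z s _ lt; rewrite !big_cons.
  apply: ltr_leD; first by apply: lt; rewrite mem_head.
  rewrite !big_seq; apply: ler_sum => w ws; apply/ltW/lt; by rewrite inE ws orbT.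
suff hlo : c * (D%:R / 2) <= \sum_(z <- double_sums xs) fejer D (z - u).
  by have := lt_le_trans hup hlo; rewrite ltxx.
set s := \sum_(x <- xs) x in hu *.
pose g h : R := if (Y <= h)%N then cos_weight xs h else 0.
have g0 h : 0 <= g h by rewrite /g; case: ifP => // _; exact: cos_weight_ge0.
have -> : \sum_(z <- double_sums xs) fejer D (z - u) =
  c * \sum_(0 <= i < D) \sum_(0 <= j < D)
    (cos_weight xs ((i - j) + (j - i)) * cos (2 * pi * (i%:R - j%:R) * (s - u))).
  rewrite /fejer exchange_big /= mulr_sumr; apply: eq_bigr => i _.
  rewrite exchange_big /= mulr_sumr; apply: eq_bigr => j _.
  pose t : R := 2 * pi * (i%:R - j%:R).
  rewrite (eq_bigr (fun z => cos (- (t * u) + t * z))); last first.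
    by move=> z _; congr cos; rewrite /t; ring.
  rewrite sum_cos_double_sums -/n -/c -/s -mulrA; congr (_ * (_ * _)); last first.
    by congr cos; rewrite /t; ring.
  apply: eq_bigr => x _.
  have -> : t * x / 2 = pi * (i%:R - j%:R) * x by rewrite /t; field.
  have [ij|ij] := leqP i j.
    have -> : ((i - j) + (j - i))%:R = - (i%:R - j%:R) :> R.
      have /eqP -> : (i - j == 0)%N by rewrite subn_eq0.
      by rewrite add0n natrB // opprB.
    by rewrite mulrN mulNr cosN.
  have -> // : ((i - j) + (j - i))%:R = (i%:R - j%:R) :> R.
  have /eqP -> : (j - i == 0)%N by rewrite subn_eq0 ltnW.
  by rewrite addn0 natrB // ltnW.
rewrite ler_pM2l //.
have hg : \sum_(0 <= h < D) g h <= 1 / 4.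
  by rewrite /g -big_mkcond.
have g00 : g 0%N = 0 by rewrite /g leqn0; case: eqP => // E; rewrite E in Y0.
apply: (@le_trans _ _ (\sum_(0 <= i < D) (1 - 2 * \sum_(0 <= h < D) g h))).
  rewrite big_const_nat iter_addr_0 subn0 -mulr_natl; nra.
apply: ler_sum_nat => i /andP[_ iD].
apply: (@le_trans _ _ (\sum_(0 <= j < D) ((i == j)%:R - g ((i - j) + (j - i))%N))).
  rewrite sumrB; apply: lerB; last exact: sum_dist_le.
  rewrite (bigD1_seq i) ?iota_uniq ?mem_index_iota //= eqxx lerDl.
  by apply: sumr_ge0 => j _; rewrite ler0n.
apply: ler_sum_nat => j /andP[_ jD].
have [<-|ij] := eqVneq i j.
  rewrite subnn addn0 g00 subr0 subrr mulr0 mul0r cos0 mulr1 /cos_weight big1 //.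
  by move=> x _; rewrite mulr0 mul0r cos0 expr1n.
rewrite sub0r /g; set h := ((i - j) + (j - i))%N.
have w0 := cos_weight_ge0 xs h.
case: ifP => hY; first by have := cos_geN1 (2 * pi * (i%:R - j%:R) * (s - u)); nra.
rewrite oppr0; apply: mulr_ge0 => //; apply: cos_ge0_pihalf; rewrite -ler_norml.
rewrite !normrM (ger0_norm (pi_ge0 R)) (ger0_norm (ler0n R 2)).
have -> : `|i%:R - j%:R| = h%:R :> R.
  have [le|lt] := leqP i j.
    by rewrite distrC ger0_norm ?subr_ge0 ?ler_nat // -natrB // /h; congr _%:R; lia.
  by rewrite ger0_norm ?subr_ge0 ?ler_nat 1?ltnW // -natrB 1?ltnW // /h; congr _%:R; lia.
have hY' : h%:R <= Y%:R :> R by rewrite ler_nat leqNgt; apply/negP => /ltnW; rewrite hY.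
have pg := pi_ge0 R; have n0 : 0 <= `|s - u| by [].
have : h%:R * `|s - u| <= 1 / 4 by have := ler_wpM2r n0 hY'; lra.
rewrite -!mulrA; nra.
Qed.

(** * Multiplicity functions, merging and the greedy algorithm *)

(** A multiset is handled through its multiplicity function [m], restricted to
    the integers below [X]; the convention 1/0 = 0 makes the index 0 harmless. *)
Definition mass (R : realType) (X : nat) (m : nat -> nat) : R :=
  \sum_(0 <= a < X) (m a)%:R / a%:R.
Arguments mass : clear implicits.

Definition set_mult (m : nat -> nat) (a v : nat) : nat -> nat :=
  fun c => if c == a then v else m c.

Definition subsum (R : realType) (X : nat) (m : nat -> nat) (z : R) : Prop :=
  exists2 k, (forall a, (k a <= m a)%N) & z = mass R X k.

Lemma mass_add (R : realType) (X : nat) (m k : nat -> nat) :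
  mass R X (fun a => m a + k a)%N = mass R X m + mass R X k.
Proof.
by rewrite /mass -big_split /=; apply: eq_bigr => a _; rewrite natrD mulrDl.
Qed.

Lemma mass0 (R : realType) (X : nat) : mass R X (fun=> 0%N) = 0.
Proof. by rewrite /mass big1 // => a _; rewrite mul0r. Qed.

Lemma mass_set_mult (R : realType) (X : nat) (m : nat -> nat) (a v : nat) :
  (a < X)%N ->
  mass R X (set_mult m a v) = mass R X m - (m a)%:R / a%:R + v%:R / a%:R.
Proof.
move=> aX; rewrite /mass.
rewrite (bigD1_seq a) ?iota_uniq ?mem_index_iota //=.
rewrite [in RHS](bigD1_seq a) ?iota_uniq ?mem_index_iota //= /set_mult eqxx.
rewrite (eq_bigr (fun b => (m b)%:R / b%:R)); first by ring.
by move=> b /negbTE ->.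
Qed.

Definition count_total (X : nat) (m : nat -> nat) : nat := \sum_(0 <= a < X) m a.

Lemma count_total_set_mult (X : nat) (m : nat -> nat) (a v : nat) :
  (a < X)%N -> (count_total X (set_mult m a v) + m a = count_total X m + v)%N.
Proof.
move=> aX; rewrite /count_total.
rewrite (bigD1_seq a) ?iota_uniq ?mem_index_iota //=.
rewrite [in RHS](bigD1_seq a) ?iota_uniq ?mem_index_iota //= /set_mult eqxx.
rewrite (eq_bigr m); first by lia.
by move=> b /negbTE ->.
Qed.

(** A subsum of [m'] that uses the new copy of [a %/ pdiv a] is a subsum of [m]
    that uses [pdiv a] more copies of [a] instead. *)
Lemma merge_step (R : realType) (X : nat) (m : nat -> nat) (a : nat) (m' := 
    set_mult (set_mult m a (m a - pdiv a)%N) (a %/ pdiv a)%N (m (a %/ pdiv a)%N).+1) :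
  (1 < a < X)%N -> (pdiv a <= m a)%N ->
  [/\ (count_total X m' < count_total X m)%N, mass R X m' = mass R X m, m' 0%N = m 0%N
    & forall z : R, subsum X m' z -> subsum X m z].
Proof.
move=> /andP[a1 aX] pm.
set p := pdiv a in m' pm *; set b := (a %/ p)%N in m' *.
have p1 : (1 < p)%N by rewrite prime_gt1 // pdiv_prime.
have pb : (a = b * p)%N by rewrite /b divnK // pdiv_dvd.
have b0 : (0 < b)%N by rewrite lt0n; apply/eqP => E; move: a1; rewrite pb E.
have ba : (b < a)%N by rewrite pb -[X in (X < _)%N]muln1 ltn_pmul2l.
have bX : (b < X)%N := ltn_trans ba aX.
have bna : (b == a) = false by apply/eqP => E; rewrite E ltnn in ba.
have frac : p%:R / a%:R = 1 / b%:R :> R.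
  by rewrite pb natrM; field; rewrite !pnatr_eq0 -!lt0n b0 ltnW.
have m1b : set_mult m a (m a - p) b = m b by rewrite /set_mult bna.
split.
- have := count_total_set_mult (set_mult m a (m a - p)) (m b).+1 bX.
  have := count_total_set_mult m (m a - p) aX.
  rewrite -/m' m1b; lia.
- rewrite /m' !mass_set_mult // m1b natrB // -natr1 mulrBl mulrDl frac; ring.
- rewrite /m' /set_mult !ifN //; apply/eqP; lia.
move=> z [k km ->].
have ka : (k a <= m a - p)%N by have := km a; rewrite /m' /set_mult eq_sym bna eqxx.
have kc c : c != a -> c != b -> (k c <= m c)%N.
  by move=> ca cb; have := km c; rewrite /m' /set_mult (negbTE ca) (negbTE cb).
have [kb|kb] := leqP (k b) (m b).
  exists k => // c; have [->|ca] := eqVneq c a; first by lia.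
  have [->|cb] := eqVneq c b; [exact: kb | exact: kc].
exists (set_mult (set_mult k a (k a + p)) b (m b)).
  move=> c; rewrite /set_mult; case: eqP => [->//|/eqP cb].
  case: eqP => [->|/eqP ca]; [lia | exact: kc].
have kbE : k b = (m b).+1.
  by apply/eqP; rewrite eqn_leq kb andbT; have := km b; rewrite /m' /set_mult eqxx.
rewrite !mass_set_mult // {1}/set_mult bna kbE natrD -natr1 !mulrDl frac; ring.
Qed.

(** Merging decreases the number of elements, so it stops. *)
Lemma merge_copies (R : realType) (X : nat) (m : nat -> nat) :
  m 0%N = 0%N -> exists m' : nat -> nat,
  [/\ m' 0%N = 0%N, mass R X m' = mass R X m,
      forall z : R, subsum X m' z -> subsum X m z
    & forall a, (1 < a < X)%N -> (m' a < pdiv a)%N].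
Proof.
have [n] := ubnP (count_total X m); elim: n m => // n IH m hn m0.
case: (boolP (has (fun a => (1 < a)%N && (pdiv a <= m a)%N) (index_iota 0 X))).
  move=> /hasP[a]; rewrite mem_index_iota => /andP[_ aX] /andP[a1 pm].
  have [c1 c2 c3 c4] := @merge_step R X m a (introT andP (conj a1 aX)) pm.
  have [|m' [h1 h2 h3 h4]] := IH _ (leq_trans c1 hn); first by rewrite c3.
  by exists m'; split=> //; [rewrite h2 | move=> z /h3 /c4].
move=> /hasPn h; exists m; split=> // a /andP[a1 aX].
by have := h a; rewrite mem_index_iota aX a1 /= ltnNge => ->.
Qed.

(** Remove elements until the sum first drops to [t] or below; the last removed
    element is at most 1/x. *)
Lemma greedy (R : realType) (X x : nat) (m : nat -> nat) (t : R) :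
  (forall a, (a < x)%N -> m a = 0%N) -> (0 < x)%N -> 0 <= t <= mass R X m ->
  exists k, [/\ forall a, (k a <= m a)%N, t - x%:R^-1 < mass R X k & mass R X k <= t].
Proof.
move=> + x0; have [n] := ubnP (count_total X m); elim: n m => // n IH m hn mx /andP[t0 tm].
have xi : 0 < x%:R^-1 :> R by rewrite invr_gt0 ltr0n.
have [mt|mt] := lerP (mass R X m) t.
  by exists m; split=> //; lra.
have : has (fun a => 0 < m a)%N (index_iota 0 X).
  apply/negPn/negP => /hasPn h; have := le_lt_trans t0 mt.
  rewrite /mass big_seq big1 ?ltxx // => a aX; have := h a aX.
  by rewrite -leqNgt leqn0 => /eqP ->; rewrite mul0r.
move=> /hasP[a]; rewrite mem_index_iota => /andP[_ aX] ma.
have xa : (x <= a)%N by rewrite leqNgt; apply/negP => /mx E; rewrite E in ma.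
pose m' := set_mult m a (m a).-1.
have m'm c : (m' c <= m c)%N.
  by rewrite /m' /set_mult; case: eqP => [->|//]; rewrite leq_pred.
have massm' : mass R X m' = mass R X m - a%:R^-1.
  rewrite /m' mass_set_mult // -[in (m a)%:R](prednK ma) -natr1; ring.
have ai : a%:R^-1 <= x%:R^-1 :> R by rewrite lef_pV2 ?posrE ?ltr0n ?ler_nat //; lia.
have [tm'|tm'] := lerP t (mass R X m'); last first.
  by exists m'; split=> //; [rewrite massm'; lra | exact: ltW].
have [|c|k [k1 k2 k3]] := IH m' _ _ (introT andP (conj t0 tm')).
- have := count_total_set_mult m (m a).-1 aX; rewrite -/m'; lia.
- by move=> cx; apply/eqP; rewrite -leqn0 -(mx c cx).
by exists k; split=> // c; exact: leq_trans (k1 c) (m'm c).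
Qed.

(** The gadget [(a, n)] stands for two blocks of [n] copies of [a]. *)
Definition gadget_value (R : realType) (g : nat * nat) : R := g.2%:R / g.1%:R.
Arguments gadget_value : clear implicits.

Fixpoint gadget_use (gs : seq (nat * nat)) (a : nat) : nat :=
  if gs is g :: gs' then
    ((if a == g.1 then 2 * g.2 else 0) + gadget_use gs' a)%N
  else 0%N.

Lemma double_sums_mass (R : realType) (X : nat) (gs : seq (nat * nat)) (z : R) :
  all (fun g => g.1 < X)%N gs ->
  z \in double_sums (map (gadget_value R) gs) -> subsum X (gadget_use gs) z.
Proof.
elim: gs z => [|g gs IH] z /=.
  by rewrite inE => _ /eqP ->; exists (fun=> 0%N); rewrite ?mass0.
move=> /andP[gX gsX].
have add j w : (j <= 2)%N -> w \in double_sums (map (gadget_value R) gs) ->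
    subsum X (fun a => (if a == g.1 then 2 * g.2 else 0) + gadget_use gs a)%N
      (j%:R * gadget_value R g + w).
  move=> j2 /(IH _ gsX)[k kg ->].
  exists (set_mult k g.1 (k g.1 + j * g.2)%N).
    move=> a; rewrite /set_mult; case: eqP => [->|_]; last by rewrite kg.
    by rewrite addnC leq_add // leq_mul2r j2 orbT.
  rewrite mass_set_mult // natrD natrM /gadget_value; ring.
rewrite !mem_cat => /or4P[h|/mapP[w h ->]|/mapP[w h ->]|/mapP[w h ->]].
- by have := add 0%N z isT h; rewrite mul0r add0r.
- by have := add 1%N w isT h; rewrite mul1r.
- by have := add 1%N w isT h; rewrite mul1r.
- by have := add 2%N w isT h; rewrite mulr_natl mulr2n.
Qed.

(** * The mass of the integers with a multiple close to h *)

Definition harmonic_sum (R : realType) (X : nat) : R := \sum_(0 <= b < X) b%:R^-1.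
Arguments harmonic_sum : clear implicits.

Lemma harmonic_sum_ge0 (R : realType) (X : nat) : 0 <= harmonic_sum R X.
Proof. by apply: sumr_ge0 => b _; rewrite invr_ge0 ler0n. Qed.

(** The masses below are bounded by grouping the integers [a] according to a
    parameter [f a] that leaves few possibilities for [a]. *)
Lemma sum_fiber_le (R : realType) (P : pred nat) (f : nat -> nat) (F : nat -> R)
    (X k : nat) :
  (forall b, 0 <= F b) -> (forall a, (a < X)%N -> P a -> (f a < X)%N) ->
  (forall b, (size [seq a <- index_iota 0 X | P a && (f a == b)] <= k)%N) ->
  \sum_(0 <= a < X | P a) F (f a) <= k%:R * \sum_(0 <= b < X) F b.
Proof.
move=> F0 fX hk.
have -> : \sum_(0 <= a < X | P a) F (f a) =
    \sum_(0 <= a < X | P a) \sum_(0 <= b < X | f a == b) F b.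
  rewrite big_nat_cond [RHS]big_nat_cond; apply: eq_bigr => a /andP[/andP[_ aX] Pa].
  rewrite (eq_bigl (pred1 (f a))) => [|b]; last by rewrite eq_sym.
  by rewrite -big_filter filter_pred1_uniq ?iota_uniq ?mem_index_iota ?fX // big_seq1.
rewrite (exchange_big_dep xpredT) //= mulr_sumr; apply: ler_sum => b _.
rewrite -big_filter big_const_seq count_predT iter_addr_0 -[leLHS]mulr_natl.
by rewrite ler_wpM2r // ler_nat hk.
Qed.

Lemma size_large_primes (M n N : nat) :
  (1 < M)%N -> (n <= N)%N ->
  (size [seq q <- primes n | M <= q] <= trunc_log M N)%N.
Proof.
move=> M1 nN; case: n nN => [|n] nN //; rewrite /leq; apply: trunc_log_max => //.
apply: leq_trans nN; rewrite {2}(prod_prime_decomp (ltn0Sn n)).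
rewrite size_filter -sum1_count /primes big_map expn_sum big_mkcond /= big_seq.
rewrite [X in (_ <= X)%N]big_seq; apply: leq_prod => -[p e] /=.
move=> /mem_prime_decomp[p_pr e0 _].
have p0 : (0 < p)%N by rewrite prime_gt0.
have pe : (p <= p ^ e)%N by rewrite -{1}[p]expn1 leq_pexp2l.
case: ifP => Mp; last by rewrite expn_gt0 p0.
by rewrite expn1 (leq_trans Mp).
Qed.

Definition dist_multiple (h a : nat) : nat :=
  if (2 * (h %% a) <= a)%N then (h %% a)%N else (a - h %% a)%N.

Lemma dist_multipleP (h a : nat) : (0 < a)%N ->
  (2 * dist_multiple h a <= a)%N /\ exists e, [/\ (a %| e)%N,
    h = (e + dist_multiple h a)%N \/ e = (h + dist_multiple h a)%N & (a < 2 * h)%N -> (0 < e)%N].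
Proof.
move=> a0; have hE := divn_eq h a; have rl := ltn_pmod h a0; rewrite /dist_multiple.
case: (leqP (2 * (h %% a)) a) => hr.
  split=> //; exists (h %/ a * a)%N; split; [by rewrite dvdn_mull | by left |].
  move=> ah; rewrite lt0n; apply/eqP; lia.
split; first by lia.
exists ((h %/ a).+1 * a)%N; split; [by rewrite dvdn_mull | right; lia | ].
by move=> _; rewrite muln_gt0.
Qed.

Lemma dist_multiple_small (h a : nat) : (0 < a)%N -> (2 * h <= a)%N -> dist_multiple h a = h.
Proof. by move=> a0 ha; rewrite /dist_multiple modn_small ?ha //; lia. Qed.

(** The squared sine has period pi, so only the distance from [h] to the multiples
    of [a] matters. *)
Lemma sin_sqr_dist_multiple (R : realType) (h a c : nat) : (0 < a)%N ->
  sin (pi * h%:R * (c%:R / a%:R)) ^+ 2 =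
  sin (pi * (c%:R * ((dist_multiple h a)%:R / a%:R))) ^+ 2 :> R.
Proof.
move=> a0; have [_ [e [/dvdnP[j ->] he _]]] := dist_multipleP h a0.
have an0 : a%:R != 0 :> R by rewrite pnatr_eq0 -lt0n.
set r := dist_multiple h a in he *.
have per (x : R) n : sin (x + pi *+ n) ^+ 2 = sin x ^+ 2.
  by rewrite (alternatingn (@sinDpi R)) exprMn sqrr_sign mul1r.
case: he => [->|/eqP].
  rewrite -[RHS](per _ (c * j)%N); congr (sin _ ^+ 2).
  by rewrite -[pi *+ _]mulr_natr natrD !natrM; field.
rewrite -(eqr_nat R) natrD natrM => /eqP E.
have -> : h%:R = j%:R * a%:R - r%:R :> R by rewrite E addrK.
rewrite -[RHS]sqrrN -sinN -[RHS](per _ (c * j)%N); congr (sin _ ^+ 2).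
by rewrite -[pi *+ _]mulr_natr natrM; field.
Qed.

(** Given [h] and [b], all [a] with [a %/ pdiv a = b] whose nearest multiple is within
    [b / 2] of [h] share that multiple [e], as it is the only multiple of [b] so close
    to [h].  Then [pdiv a] is a prime factor of [e %/ b], and a number up to [2 * D]
    has few prime factors above [M]. *)
Lemma composite_fiber_size (X M D h b : nat) :
  (1 < M)%N -> (h <= D)%N ->
  (size [seq a <- index_iota 0 X |
     [&& M <= pdiv a, a < 2 * h & 2 * dist_multiple h a < a %/ pdiv a] && (a %/ pdiv a == b)]
   <= trunc_log M (2 * D))%N.
Proof.
move=> M1 hD; set s := seq.filter _ _.
have s_in a : a \in s -> [/\ (0 < a)%N, a = (b * pdiv a)%N, prime (pdiv a), (M <= pdiv a)%N
    & exists e, [/\ (a %| e)%N, (0 < e <= 2 * D)%N, (2 * e < 2 * h + b)%N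
      & (2 * h < 2 * e + b)%N]].
  rewrite mem_filter => /andP[/andP[/and3P[Mp ah hb] /eqP ab] _].
  have a1 : (1 < a)%N.
    by rewrite ltnNge; apply/negP => a1; move: Mp; case: a a1 {ah hb ab} => [|[|]] // _; rewrite leqNgt M1.
  have a0 := ltnW a1; have [hra [e [ae he e0]]] := dist_multipleP h a0.
  split=> //; [by rewrite -ab divnK ?pdiv_dvd | exact: pdiv_prime |].
  by exists e; split=> //; [apply/andP; split; [exact: e0 | lia] | lia | lia].
case: (posnP (size s)) => [->//|s0].
have [a0_gt0 aE _ _ [e [ae /andP[e0 eD] he1 he2]]] := s_in _ (mem_nth 0%N s0).
set a0 := nth 0%N s 0 in a0_gt0 aE ae.
have b0 : (0 < b)%N by move: a0_gt0; rewrite aE muln_gt0 => /andP[].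
have be : (b %| e)%N by apply: dvdn_trans ae; rewrite aE dvdn_mulr.
have bD : (e %/ b <= 2 * D)%N by apply: leq_trans eD; apply: leq_div.
apply: leq_trans (size_large_primes M1 bD); rewrite -(size_map pdiv s).
apply: uniq_leq_size.
  rewrite map_inj_in_uniq ?filter_uniq ?iota_uniq // => x y /s_in[_ xE _ _ _] /s_in[_ yE _ _ _] xy.
  by rewrite xE xy -yE.
move=> _ /mapP[a /s_in[a_gt0 abE p_pr Mp [e' [ae' _ he1' he2']]] ->].
rewrite mem_filter Mp mem_primes p_pr divn_gt0 // (dvdn_leq e0 be) /=.
have be' : (b %| e')%N by apply: dvdn_trans ae'; rewrite abE dvdn_mulr.
(* Both are multiples of [b] within [b / 2] of [h]. *)
have ee : e = e'.
  have close x y : (b %| x)%N -> (b %| y)%N -> (x < y + b)%N -> (x <= y)%N.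
    move=> bx bY xy; rewrite leqNgt; apply/negP => yx.
    have xy0 : (0 < x - y)%N by rewrite subn_gt0.
    have := dvdn_leq xy0 (dvdn_sub bx bY); clear -xy yx; lia.
  have ineq : (e < e' + b)%N && (e' < e + b)%N.
    by clear -he1 he2 he1' he2'; lia.
  by case/andP: ineq => i1 i2; apply/eqP; rewrite eqn_leq (close _ _ be be' i1) (close _ _ be' be i2).
have : (b * pdiv a %| b * (e %/ b))%N by rewrite -abE mulnC divnK // ee.
by rewrite dvdn_pmul2l.
Qed.

(** Since [m a < pdiv a], the mass of [a] is less than the inverse of
    [b = a %/ pdiv a]; the sum over [b] is harmonic. *)
Lemma composite_mass_le (R : realType) (X M D h : nat) (m : nat -> nat) :
  (1 < M)%N -> (h <= D)%N -> (forall a, (a < X)%N -> (m a < pdiv a)%N) ->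
  \sum_(0 <= a < X | [&& M <= pdiv a, a < 2 * h & 2 * dist_multiple h a < a %/ pdiv a]%N)
    (m a)%:R / a%:R <= (trunc_log M (2 * D))%:R * harmonic_sum R X.
Proof.
move=> M1 hD hm; rewrite /harmonic_sum; pose f a := (a %/ pdiv a)%N.
apply: le_trans (sum_fiber_le (f := f) (F := fun b => b%:R^-1) _ _ (fun b => composite_fiber_size X b M1 hD)).
- rewrite big_nat_cond [leRHS]big_nat_cond; apply: ler_sum => a /andP[/andP[_ aX] _].
  have [->|a0] := posnP a; first by rewrite /f div0n invr0 mulr0.
  have e : a%:R = (f a)%:R * (pdiv a)%:R :> R by rewrite -natrM divnK // pdiv_dvd.
  have f0 : 0 < (f a)%:R :> R by rewrite ltr0n divn_gt0 ?pdiv_gt0 // dvdn_leq // pdiv_dvd.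
  have p0 : 0 < (pdiv a)%:R :> R by rewrite ltr0n pdiv_gt0.
  rewrite e invfM mulrA ler_pdivrMr // mulrC ler_wpM2l // ?invr_ge0 1?ltW //.
  by rewrite ltr_nat hm.
- by move=> b; rewrite invr_ge0 ler0n.
- by move=> a aX _; apply: leq_ltn_trans aX; exact: leq_div.
Qed.

Lemma prime_fiber_size (X M D h r : nat) :
  (1 < M)%N -> (h <= D)%N ->
  (size [seq a <- index_iota 0 X |
     [&& prime a, M <= a & a < 2 * h]%N && (dist_multiple h a == r)]
   <= 2 * trunc_log M (2 * D))%N.
Proof.
move=> M1 hD; set s := seq.filter _ _.
have [->//|sn] := eqVneq s [::].
have s_in a : a \in s -> [/\ prime a, (M <= a)%N, (0 < h - r)%N, (h + r <= 2 * D)%N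
    & (a %| h + r)%N || (a %| h - r)%N].
  rewrite mem_filter => /andP[/andP[/and3P[a_pr Ma ah] /eqP <-] _].
  have [hra [e [ae he e0]]] := dist_multipleP h (prime_gt0 a_pr).
  have {}e0 := e0 ah; case: he => he; split=> //; try lia.
    have hE : e = (h - dist_multiple h a)%N by lia.
    by rewrite -hE ae orbT.
  by rewrite -he ae.
have [a0 a0s] : exists a, a \in s by case: (s) sn => // x t _; exists x; rewrite mem_head.
have [_ _ hr0 hrD _] := s_in _ a0s.
have k1 := size_large_primes M1 hrD.
have k2 := size_large_primes M1 (leq_trans (leq_subr r h) (leq_trans (leq_addr r h) hrD)).
apply: (@leq_trans (size ([seq q <- primes (h + r) | M <= q] ++
                          [seq q <- primes (h - r) | M <= q])%N)); last first.
  by rewrite size_cat mul2n -addnn leq_add.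
apply: uniq_leq_size; first by rewrite filter_uniq ?iota_uniq.
move=> a /s_in[a_pr Ma _ _ ad]; rewrite mem_cat !mem_filter Ma /= !mem_primes a_pr hr0 /=.
by rewrite (leq_trans hr0) // (leq_trans (leq_subr _ _)) ?leq_addr.
Qed.

(** The primes at a given distance [r] from [h] divide [h + r] or [h - r], so they are
    few.  Each has mass at most 1, and at most 2/r if [2 * l <= r]: this gives
    [2 * l] from the small distances and a harmonic sum from the large ones. *)
Lemma prime_mass_le (R : realType) (X M D h l : nat) (m : nat -> nat) :
  (1 < M)%N -> (h <= D)%N -> (0 < l)%N -> (forall a, (a < X)%N -> (m a < pdiv a)%N) ->
  \sum_(0 <= a < X | [&& prime a, M <= a & a < 2 * h]%N &&
     ((dist_multiple h a < 2 * l) || (m a * dist_multiple h a ^ 2 < 4 * l * a))%N)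
    (m a)%:R / a%:R <=
  2 * (trunc_log M (2 * D))%:R * (2 * l%:R + 2 * harmonic_sum R X).
Proof.
move=> M1 hD l0 hm.
pose P a := [&& prime a, M <= a & a < 2 * h]%N.
pose F (r : nat) : R := (r < 2 * l)%N%:R + 2 * r%:R^-1.
have F0 r : 0 <= F r by rewrite addr_ge0 // ?ler0n // mulr_ge0 // ?invr_ge0 ler0n.
have FX : \sum_(0 <= r < X) F r <= 2 * l%:R + 2 * harmonic_sum R X.
  rewrite big_split /= -mulr_sumr lerD2r.
  have [lX|/ltnW Xl] := leqP (2 * l) X; last first.
    apply: (@le_trans _ _ (\sum_(0 <= r < X) 1)).
      by apply: ler_sum => r _; rewrite lern1 leq_b1.
    by rewrite big_const_nat iter_addr_0 subn0 -natrM ler_nat.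
  rewrite (big_cat_nat _ lX) //= [X in _ + X]big_nat_cond [X in _ + X]big1 ?addr0.
    apply: (@le_trans _ _ (\sum_(0 <= r < 2 * l) 1)).
      by apply: ler_sum => r _; rewrite lern1 leq_b1.
    by rewrite big_const_nat iter_addr_0 subn0 -natrM.
  by move=> r /andP[/andP[h1 _] _]; rewrite ltnNge h1.
apply: le_trans (_ : _ <= (2 * trunc_log M (2 * D))%:R * \sum_(0 <= r < X) F r) _; last first.
  by rewrite natrM; apply: ler_wpM2l => //; rewrite mulr_ge0 ?ler0n.
apply: le_trans (sum_fiber_le (f := dist_multiple h) F0 _ (fun r => prime_fiber_size X r M1 hD)); last first.
  move=> a aX /and3P[a_pr _ _]; have [h1 _] := dist_multipleP h (prime_gt0 a_pr).
  by apply: leq_ltn_trans aX; lia.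
rewrite -/P; apply: (@le_trans _ _ (\sum_(0 <= a < X | P a && 
     ((dist_multiple h a < 2 * l) || (m a * dist_multiple h a ^ 2 < 4 * l * a))%N) F (dist_multiple h a))); last first.
  rewrite [leLHS]big_mkcondr; apply: ler_sum => a _.
  by case: ifP.
rewrite big_nat_cond [leRHS]big_nat_cond; apply: ler_sum => a /andP[/andP[_ aX] /andP[Pa bad]].
have a_pr : prime a by case/and3P: Pa.
have a0 : 0 < a%:R :> R by rewrite ltr0n prime_gt0.
have ma : (m a)%:R / a%:R <= 1 :> R.
  by rewrite ler_pdivrMr // mul1r ler_nat; have := hm a aX; rewrite pdiv_id // => /ltnW.
set r := dist_multiple h a in bad *.
have [rl|rl] := ltnP r (2 * l).
  by rewrite /F rl (le_trans ma) // lerDl mulr_ge0 // invr_ge0 ler0n.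
rewrite ltnNge rl /= in bad; rewrite /F ltnNge rl add0r.
have r0 : 0 < r%:R :> R by rewrite ltr0n; lia.
rewrite ler_pdivrMr // -mulrA mulrCA ler_pdivlMl // mulrC.
rewrite -!natrM ler_nat -(leq_pmul2r (m := 2 * l)) ?muln_gt0 //.
move: bad; rewrite expnS expn1; nia.
Qed.

(** * One good gadget *)

Lemma sin_sqr_ge_half (R : realType) (x : R) :
  1 / 4 <= x <= 1 / 2 -> 1 / 2 <= sin (pi * x) ^+ 2.
Proof.
move=> /andP[x1 x2]; have pg := pi_ge0 R.
have h : 0 <= sin ((pi * x) *+ 2 - pi / 2).
  by apply: sin_ge0_pi; rewrite -mulr_natl; apply/andP; split; nra.
rewrite sinBpihalf cos_mulr2n in h; rewrite sin2cos2; lra.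
Qed.

(** Doubling [x] until it enters [1/4, 1/2] makes the sine large; if [2 ^ s] is too
    small for that, the last multiple has the largest sine. *)
Lemma sin_dyadic_ge (R : realType) (s : nat) (x : R) : 0 <= x <= 1 / 2 ->
  exists2 i, (i <= s)%N & Num.min (1 / 2) ((2 ^+ s * x) ^+ 2) <= sin (pi * (2 ^+ i * x)) ^+ 2.
Proof.
move=> /andP[x0 x1].
have p0 n : 0 < 2 ^+ n :> R by rewrite exprn_gt0.
have [h|h] := lerP (2 ^+ s * x) (1 / 2).
  exists s => //; rewrite ge_min; apply/orP; right.
  have y0 : 0 <= 2 ^+ s * x by rewrite mulr_ge0 // ltW.
  have hs := sin_pi_ge (introT andP (conj y0 h)).
  by rewrite !expr2; apply: ler_pM.
have [i is_ /andP[i1 i2]] : exists2 i, (i <= s)%N & 1 / 4 <= 2 ^+ i * x <= 1 / 2.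
  elim: s h => [|s IH]; first by rewrite expr0 mul1r => h; lra.
  move=> h; have [h'|h'] := lerP (2 ^+ s * x) (1 / 2); last first.
    by have [i is_ hi] := IH h'; exists i => //; exact: ltnW.
  by exists s => //; rewrite h' andbT; move: h; rewrite exprS -mulrA; lra.
exists i => //; rewrite ge_min; apply/orP; left.
by apply: sin_sqr_ge_half; rewrite i1.
Qed.

(** The gadgets of [a] are [(a, 2 ^ i)] with [i <= gadget_exp l m a].  The bound keeps
    [2 * 2 ^ i] below both the multiplicity of [a] and [a / l]; the latter makes the
    values at most [1 / (2 * l)]. *)
Definition gadget_exp (l : nat) (m : nat -> nat) (a : nat) : nat :=
  (trunc_log 2 (minn (m a) (a %/ l))).-1.

Lemma gadget_expP (l X : nat) (m : nat -> nat) (a : nat) (s := gadget_exp l m a) :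
  (0 < l)%N -> (a < X)%N -> (forall a, (a < X)%N -> (m a < pdiv a)%N) ->
  (64 * l <= m a)%N ->
  [/\ (64 * l < a)%N, (2 * 2 ^ s <= m a)%N, (2 * 2 ^ s * l <= a)%N
    & (m a < 4 * 2 ^ s)%N || (a < 4 * 2 ^ s * l)%N].
Proof.
move=> l0 aX hm Ma.
have la : (64 * l < a)%N.
  have := hm a aX; have [a00|a0] := posnP a.
    by rewrite [X in (_ < pdiv X)%N]a00 (_ : pdiv 0 = 1)%N //; lia.
  have := dvdn_leq a0 (pdiv_dvd a); lia.
set v := minn (m a) (a %/ l).
have v2 : (2 <= v)%N.
  rewrite leq_min; apply/andP; split; first by lia.
  by rewrite leq_divRL //; lia.
have t1 : (0 < trunc_log 2 v)%N by apply: trunc_log_max.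
have sE : (2 * 2 ^ s = 2 ^ trunc_log 2 v)%N by rewrite -expnS /s /gadget_exp prednK.
have /andP[b1 b2] := trunc_log_bounds (isT : (1 < 2)%N) (ltnW v2).
rewrite -sE in b1.
have b2' : (v < 4 * 2 ^ s)%N by move: b2; rewrite expnS -sE; lia.
split=> //.
- by apply: leq_trans b1 _; rewrite geq_minl.
- by rewrite -leq_divRL //; apply: leq_trans b1 _; rewrite geq_minr.
- by move: b2'; rewrite gtn_min => /orP[->//|]; rewrite ltn_divLR // => ->; rewrite orbT.
Qed.

(** With x the distance from [h / a] to the integers and [n = 2 ^ gadget_exp l m a], this
    says that [(n * x) ^ 2 < l * (n / a)]: then no gadget of [a] is guaranteed to act
    on the frequency [h] in proportion to its size. *)
Definition nearly_divides (l : nat) (m : nat -> nat) (h a : nat) : bool :=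
  (2 ^ gadget_exp l m a * dist_multiple h a ^ 2 < l * a)%N.

(** The threshold [64 * l] on the multiplicity is used three times: it excludes the
    case [2 * h <= a], where the distance is [h] itself and thus at least [a / 8];
    and for composite [a = q * b], where [q <= b], it yields [2 * r < b] from either of
    the two bounds on the distance [r], one for each way in which [gadget_exp] can be
    limited. *)
Lemma nearly_divides_cases (l X : nat) (m : nat -> nat) (h a : nat) :
  (0 < l)%N -> (a < X)%N -> (forall a, (a < X)%N -> (m a < pdiv a)%N) ->
  (64 * l <= m a)%N -> (a <= 8 * h)%N -> nearly_divides l m h a ->
  [&& 64 * l <= pdiv a, a < 2 * h & 2 * dist_multiple h a < a %/ pdiv a]%N ||
  ([&& prime a, 64 * l <= a & a < 2 * h]%N &&
     ((dist_multiple h a < 2 * l) || (m a * dist_multiple h a ^ 2 < 4 * l * a))%N).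
Proof.
move=> l0 aX hm Ma ah; rewrite /nearly_divides.
have [la s1 s2 s3] := gadget_expP l0 aX hm Ma.
set s := gadget_exp l m a in s1 s2 s3 *; set r := dist_multiple h a => hb.
have a0 : (0 < a)%N by lia.
have s0 : (0 < 2 ^ s)%N by rewrite expn_gt0.
have qa : (64 * l < pdiv a)%N by apply: leq_ltn_trans Ma (hm a aX).
have h2 : (a < 2 * h)%N.
  rewrite ltnNge; apply/negP => h2; have rh : r = h := dist_multiple_small a0 h2.
  rewrite rh in hb.
  have : (h ^ 2 < l * a)%N by apply: leq_ltn_trans hb; rewrite leq_pmull.
  rewrite !expnS expn0 muln1 => hh; nia.
have dd : (r < 2 * l)%N || (m a * r ^ 2 < 4 * l * a)%N.
  case/orP: s3 => s3.
    apply/orP; right; apply: (@leq_ltn_trans (4 * (2 ^ s * r ^ 2))%N); last by lia.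
    by rewrite mulnA leq_mul2r ltnW ?orbT.
  apply/orP; left; rewrite -(ltn_exp2r r (2 * l) (isT : 0 < 2)%N).
  rewrite -(ltn_pmul2r a0).
  apply: (@leq_ltn_trans (4 * l * (2 ^ s * r ^ 2))%N).
    by rewrite (_ : 4 * l * _ = r ^ 2 * (4 * 2 ^ s * l))%N ?leq_mul2l 1?ltnW ?orbT //; ring.
  by rewrite expnMn; move: hb; rewrite -(ltn_pmul2l (_ : 0 < 4 * l)%N) ?muln_gt0 ?l0 //; lia.
rewrite h2 dd (ltnW la) (ltnW qa) /= !andbT.
have [//|/negP a_np] := boolP (prime a); first by rewrite orbT.
rewrite orbF; set q := pdiv a in qa *.
have aE : a = (a %/ q * q)%N by rewrite divnK // pdiv_dvd.
have qb : (q <= a %/ q)%N.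
  rewrite leq_divRL ?pdiv_gt0 //; rewrite leqNgt; apply/negP => H; apply: a_np.
  by apply: ltn_pdiv2_prime; rewrite // expnS expn1.
set b := (a %/ q)%N in aE qb *; case/orP: dd => dd; first by lia.
rewrite expnS expn1 in dd.
have : (16 * (r * r) < b * b)%N.
  have h1 : (64 * l * (r * r) <= m a * (r * r))%N by rewrite leq_mul2r Ma orbT.
  have h3 : (a <= b * b)%N by rewrite aE leq_mul2l qb orbT.
  have h4 : (4 * l * (16 * (r * r)) < 4 * l * a)%N by lia.
  by rewrite ltn_pmul2l ?muln_gt0 ?l0 // in h4; apply: leq_trans h3.
clear; nia.
Qed.

Definition large_mass (R : realType) (X M : nat) (m : nat -> nat) : R :=
  \sum_(0 <= a < X | (M <= m a)%N) (m a)%:R / a%:R.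
Arguments large_mass : clear implicits.

Definition nearly_divides_bound (R : realType) (X D l : nat) : R :=
  (trunc_log (64 * l) (2 * D))%:R * (4 * l%:R + 5 * harmonic_sum R X).
Arguments nearly_divides_bound : clear implicits.

Lemma nearly_divides_mass_le (R : realType) (l X D : nat) (m : nat -> nat) (h : nat) :
  (0 < l)%N -> (forall a, (a < X)%N -> (m a < pdiv a)%N) -> (X <= 8 * h)%N -> (h <= D)%N ->
  \sum_(0 <= a < X | (64 * l <= m a)%N && nearly_divides l m h a) (m a)%:R / a%:R <= nearly_divides_bound R X D l.
Proof.
move=> l0 hm Xh hD; have M1 : (1 < 64 * l)%N by lia.
have c1 := composite_mass_le R M1 hD hm.
have c2 := prime_mass_le R M1 hD l0 hm.
set k : R := (trunc_log _ _)%:R in c1 c2.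
have -> : nearly_divides_bound R X D l = k * harmonic_sum R X +
    2 * k * (2 * l%:R + 2 * harmonic_sum R X) by rewrite /nearly_divides_bound -/k; ring.
apply: le_trans (lerD c1 c2).
rewrite big_nat_cond [X in _ <= X + _]big_mkcond [X in _ <= _ + X]big_mkcond /= -big_split /=.
rewrite big_mkcond /= [leRHS]big_nat_cond [leLHS]big_mkcond /= [leRHS]big_mkcond /=.
apply: ler_sum => a _; have mu0 : 0 <= (m a)%:R / a%:R :> R by rewrite divr_ge0.
case: ifP; last by case: ifP => _ _ //; rewrite addr_ge0 //; case: ifP.
move=> /andP[aX /andP[Ma ba]]; rewrite aX.
have := nearly_divides_cases l0 aX hm Ma (ltnW (leq_trans aX Xh)) ba.
by case/orP => -> /=; [rewrite lerDl | rewrite lerDr]; case: ifP.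
Qed.

Lemma sum_ge0_exists (R : realType) (I : eqType) (r : seq I) (P : pred I) (F : I -> R) :
  has P r -> 0 <= \sum_(i <- r | P i) F i -> exists i, [/\ i \in r, P i & 0 <= F i].
Proof.
move=> hP F0; case: (boolP (has (fun i => P i && (0 <= F i)) r)) => [/hasP[i ir /andP[Pi Fi]]|].
  by exists i.
move=> /hasPn hn; move: F0; rewrite leNgt => /negP[].
have neg i : i \in r -> P i -> F i < 0.
  by move=> ir Pi; have := hn i ir; rewrite Pi -ltNge.
elim: r hP neg {hn} => //= x r IH hP neg; rewrite big_cons.
have tail_le : \sum_(i <- r | P i) F i <= 0.
  by rewrite big_seq_cond; apply: sumr_le0 => i /andP[ir Pi]; rewrite ltW // neg // inE ir orbT.
case: ifP hP => [Px _|_ /= hr].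
  by have := neg x (mem_head _ _) Px; lra.
by apply: IH => // i ir; apply: neg; rewrite inE ir orbT.
Qed.

Definition gadget_gain (R : realType) (l h a i : nat) : R :=
  sin (pi * h%:R * ((2 ^ i)%:R / a%:R)) ^+ 2 - l%:R / 4 * ((2 ^ i)%:R / a%:R).

(** The weight given to the gadgets of [a] in the averaging argument: with it, the
    largest gadget of [a] counts for the whole mass of [a]. *)
Definition copies_per_gadget (R : realType) (l : nat) (m : nat -> nat) (a : nat) : R :=
  (m a)%:R / (2 ^ gadget_exp l m a)%:R.
Arguments copies_per_gadget : clear implicits.

(** The gadgets of [a] have total size less than twice the largest one, so the
    negative terms cost at most [l / 2] times the mass of [a]; if [a] does not nearly
    divide [h], [sin_dyadic_ge] provides a positive term worth twice that. *)
Lemma sum_gadget_gain (R : realType) (l X : nat) (m : nat -> nat) (h a : nat)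
    (mu := (m a)%:R / a%:R : R) :
  (0 < l)%N -> (a < X)%N -> (forall a, (a < X)%N -> (m a < pdiv a)%N) ->
  (64 * l <= m a)%N ->
  (if nearly_divides l m h a then - (l%:R / 2 * mu) else l%:R / 2 * mu) <=
  copies_per_gadget R l m a * \sum_(0 <= i < (gadget_exp l m a).+1) gadget_gain R l h a i.
Proof.
move=> l0 aX hm Ma; have [la s1 s2 _] := gadget_expP l0 aX hm Ma.
rewrite /copies_per_gadget /nearly_divides; set s := gadget_exp l m a in s1 s2 *.
set r := dist_multiple h a; set S := \sum_(_ <= _ < _) _.
have a0 : (0 < a)%N by lia.
have aR : 0 < a%:R :> R by rewrite ltr0n.
have pR : 0 < (2 ^ s)%:R :> R by rewrite ltr0n expn_gt0.
have m0 : 0 <= (m a)%:R :> R by rewrite ler0n.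
have l0R : 0 < l%:R :> R by rewrite ltr0n.
pose T : R := \sum_(0 <= i < s.+1) sin (pi * h%:R * ((2 ^ i)%:R / a%:R)) ^+ 2.
have ST : T - l%:R / 2 * ((2 ^ s)%:R / a%:R) <= S.
  rewrite /S /gadget_gain sumrB lerD2l lerN2 -mulr_sumr -mulr_suml.
  have -> : l%:R / 2 * ((2 ^ s)%:R / a%:R) = l%:R / 4 * ((2 * 2 ^ s)%:R / a%:R) :> R.
    by rewrite natrM; field; rewrite gt_eqF.
  apply: ler_wpM2l; first by rewrite divr_ge0.
  apply: ler_wpM2r; first by rewrite invr_ge0 ler0n.
  rewrite -natr_sum ler_nat.
  have : (\sum_(0 <= i < s.+1) 2 ^ i + 1 = 2 * 2 ^ s)%N.
    elim: (s) => [|n IH]; first by rewrite big_nat1.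
    by rewrite big_nat_recr //= expnS; lia.
  lia.
have cE : (m a)%:R / (2 ^ s)%:R * ((2 ^ s)%:R / a%:R) = mu.
  by rewrite /mu; field; rewrite !gt_eqF.
set c : R := (m a)%:R / (2 ^ s)%:R in cE *.
have c0 : 0 <= c by rewrite divr_ge0 // ltW.
have cE2 : c * (l%:R / 2 * ((2 ^ s)%:R / a%:R)) = l%:R / 2 * mu.
  by rewrite mulrCA cE.
have T0 : 0 <= T by apply: sumr_ge0 => i _; exact: sqr_ge0.
case: ltnP => hb.
  apply: le_trans (ler_wpM2l c0 ST); rewrite mulrBr cE2.
  by rewrite lerDr mulr_ge0.
suff TT : l%:R * ((2 ^ s)%:R / a%:R) <= T.
  apply: le_trans (ler_wpM2l c0 ST).
  have : l%:R * mu <= c * T by rewrite -cE mulrCA ler_wpM2l.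
  rewrite mulrBr cE2; lra.
have [r2 _] := dist_multipleP h a0; rewrite -/r in r2.
pose x : R := r%:R / a%:R.
have xb : 0 <= x <= 1 / 2.
  rewrite divr_ge0 //= /x ler_pdivrMr // mulrAC ler_pdivlMr // mul1r -natrM ler_nat; lia.
have [i is_ hi] := sin_dyadic_ge s xb.
have : Num.min (1 / 2) ((2 ^+ s * x) ^+ 2) <= T.
  apply: le_trans hi _; rewrite /T (bigD1_seq i) ?iota_uniq ?mem_index_iota //=.
  rewrite sin_sqr_dist_multiple // natrX lerDl.
  by apply: sumr_ge0 => j _; exact: sqr_ge0.
apply: le_trans; rewrite le_min; apply/andP; split.
  rewrite mulrA ler_pdivrMr // mulrAC ler_pdivlMr // mul1r -!natrM ler_nat; lia.
rewrite /x -natrX mulrA mulrA expr_div_n ler_pdivrMr // mulrAC ler_pdivlMr ?exprn_gt0 //.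
rewrite -!(natrM, natrX) ler_nat expnMn.
rewrite (_ : l * 2 ^ s * a ^ 2 = (2 ^ s * a) * (l * a))%N; last by ring.
rewrite (_ : (2 ^ s) ^ 2 * r ^ 2 * a = (2 ^ s * a) * (2 ^ s * r ^ 2))%N; last by ring.
by rewrite leq_mul2l hb orbT.
Qed.

(** If the integers that nearly divide [h] carry at most half of the mass, the weighted
    gain is nonnegative for every frequency [h], hence also after summing over [h] with
    the weights [w]; so it is nonnegative for at least one gadget. *)
Lemma good_gadget (R : realType) (l X Y D : nat) (m : nat -> nat) (w : nat -> R) :
  (0 < l)%N -> (forall a, (a < X)%N -> (m a < pdiv a)%N) -> (X <= 8 * Y)%N ->
  (forall h, 0 <= w h) -> 0 < large_mass R X (64 * l) m ->
  2 * nearly_divides_bound R X D l <= large_mass R X (64 * l) m ->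
  exists g : nat * nat,
  [/\ (g.1 < X)%N, (0 < g.2)%N, (2 * g.2 <= m g.1)%N, (2 * g.2 * l <= g.1)%N &
    \sum_(0 <= h < D | (Y <= h)%N) w h * cos (pi * h%:R * gadget_value R g) ^+ 2 <=
    (1 - l%:R / 4 * gadget_value R g) * \sum_(0 <= h < D | (Y <= h)%N) w h].
Proof.
move=> l0 hm XY w0 mass0 massB.
pose G a i : R := \sum_(0 <= h < D | (Y <= h)%N) w h * gadget_gain R l h a i.
pose s := gadget_exp l m.
have l0R : 0 < l%:R :> R by rewrite ltr0n.
have tot : 0 <= \sum_(0 <= a < X | (64 * l <= m a)%N)
    copies_per_gadget R l m a * \sum_(0 <= i < (s a).+1) G a i.
  have -> : \sum_(0 <= a < X | (64 * l <= m a)%N)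
      copies_per_gadget R l m a * \sum_(0 <= i < (s a).+1) G a i =
    \sum_(0 <= h < D | (Y <= h)%N) w h * \sum_(0 <= a < X | (64 * l <= m a)%N)
      copies_per_gadget R l m a * \sum_(0 <= i < (s a).+1) gadget_gain R l h a i.
    under [RHS]eq_bigr => h _ do rewrite mulr_sumr.
    rewrite [RHS]exchange_big /=; apply: eq_bigr => a _; rewrite /G exchange_big /= mulr_sumr.
    by apply: eq_bigr => h _; rewrite -mulr_sumr mulrCA.
  rewrite big_nat_cond; apply: sumr_ge0 => h /andP[/andP[_ hD] Yh]; apply: mulr_ge0 => //.
  have Xh : (X <= 8 * h)%N by apply: leq_trans XY _; rewrite leq_mul2l Yh orbT.
  have hb := nearly_divides_mass_le R l0 hm Xh (ltnW hD).
  apply: (@le_trans _ _ (l%:R / 2 * (large_mass R X (64 * l) m -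
      2 * \sum_(0 <= a < X | (64 * l <= m a)%N && nearly_divides l m h a) (m a)%:R / a%:R))).
    by apply: mulr_ge0; [rewrite divr_ge0 | lra].
  rewrite /large_mass mulrBr big_mkcondr !mulr_sumr -sumrB.
  rewrite big_nat_cond [leRHS]big_nat_cond; apply: ler_sum => a /andP[/andP[_ aX] Ma].
  apply: le_trans (sum_gadget_gain R h l0 aX hm Ma).
  by case: ifP => _; lra.
have [|a [aX Ma Fa]] := sum_ge0_exists _ tot.
  apply/negPn/negP => /hasPn hn; move: mass0; rewrite /large_mass big_seq_cond big1 ?ltxx //.
  by move=> a /andP[ain Ma]; have := hn a ain; rewrite Ma.
rewrite mem_index_iota /= in aX.
have [la s1 s2 _] := gadget_expP l0 aX hm Ma.
have c0 : 0 < copies_per_gadget R l m a.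
  by rewrite divr_gt0 // ltr0n ?expn_gt0 //; lia.
rewrite pmulr_rge0 // in Fa.
have [|i [iin _ Gi]] := sum_ge0_exists _ Fa.
  by apply/hasP; exists 0%N; rewrite ?mem_index_iota.
rewrite mem_index_iota /= ltnS in iin.
have pis : (2 ^ i <= 2 ^ s a)%N by rewrite leq_exp2l.
exists (a, (2 ^ i)%N); split=> //=.
- by rewrite expn_gt0.
- by apply: leq_trans s1; rewrite leq_mul2l pis orbT.
- by apply: leq_trans s2; rewrite leq_mul2r leq_mul2l pis !orbT.
rewrite -subr_ge0 mulr_sumr -sumrB; move: Gi; rewrite /G.
congr (0 <= _); apply: eq_bigr => h _; rewrite /gadget_gain /gadget_value /= cos2sin2; ring.
Qed.

(** * Selecting gadgets and hitting the target *)

(** Each gadget used decreases the remaining mass by twice its value and the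
    multiplicities only decrease, so [good_gadget] applies again; the factors
    [1 - l / 4 * x] are bounded by exponentials. *)
Lemma select_gadgets (R : realType) (l X Y D : nat) (K1 : R) (m : nat -> nat)
    (w : nat -> R) (T : R) :
  (8 <= l)%N -> (X <= 8 * Y)%N ->
  (forall m, (forall a, (a < X)%N -> (m a < pdiv a)%N) -> K1 <= mass R X m ->
     0 < large_mass R X (64 * l) m /\ 2 * nearly_divides_bound R X D l <= large_mass R X (64 * l) m) ->
  (forall a, (a < X)%N -> (m a < pdiv a)%N) -> (forall h, 0 <= w h) ->
  K1 + 2 * T <= mass R X m -> - (1 / 16) <= T ->
  exists gs : seq (nat * nat), let s := \sum_(x <- map (gadget_value R) gs) x in
  [/\ all (fun g => g.1 < X)%N gs, forall a, (gadget_use gs a <= m a)%N,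
      T <= s <= T + 1 / 16 &
      \sum_(0 <= h < D | (Y <= h)%N) w h * cos_weight (map (gadget_value R) gs) h <=
      expR (- (l%:R / 4 * s)) * \sum_(0 <= h < D | (Y <= h)%N) w h].
Proof.
move=> l8 XY large; have l0 : (0 < l)%N by lia.
have [n] := ubnP (count_total X m); elim: n m w T => // n IH m w T mn hm w0 mT T16.
have [Tle|T0] := lerP T 0.
  exists [::]; rewrite /= big_nil; split=> //; first by rewrite Tle /=; lra.
  rewrite mulr0 oppr0 expR0 mul1r; apply: ler_sum => h _.
  by rewrite /cos_weight big_nil mulr1.
have [mass0 massB] : 0 < large_mass R X (64 * l) m /\
    2 * nearly_divides_bound R X D l <= large_mass R X (64 * l) m by apply: large => //; lra.
have [g [gX g0 gm gl gw]] := good_gadget l0 hm XY w0 mass0 massB.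
set v := gadget_value R g in gw.
have g1 : 0 < g.1%:R :> R by rewrite ltr0n; lia.
have v0 : 0 < v by rewrite divr_gt0 // ltr0n.
have v16 : v <= 1 / 16.
  rewrite /v /gadget_value ler_pdivrMr // mulrAC ler_pdivlMr // mul1r -natrM ler_nat.
  apply: leq_trans gl; rewrite (mulnC 2) -mulnA leq_mul2l; apply/orP; right.
  by clear -l8; lia.
pose m' := set_mult m g.1 (m g.1 - 2 * g.2)%N.
pose w' h := w h * cos (pi * h%:R * v) ^+ 2.
have m'm a : (m' a <= m a)%N by rewrite /m' /set_mult; case: eqP => [->|//]; rewrite leq_subr.
have massm' : mass R X m' = mass R X m - 2 * v.
  by rewrite /m' mass_set_mult // natrB // natrM /v /gadget_value; ring.
have [|||||gs [gsX gsm gsT gsw]] := IH m' w' (T - v) _ _ _ _ _.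
- have := count_total_set_mult m (m g.1 - 2 * g.2) gX; rewrite -/m'.
  by clear -mn g0 gm; lia.
- by move=> a aX; apply: leq_ltn_trans (m'm a) (hm a aX).
- by move=> h; rewrite mulr_ge0 // sqr_ge0.
- by rewrite massm'; lra.
- by lra.
move: gsT gsw; set s := \sum_(x <- _) x => /andP[sT1 sT2] gsw.
exists (g :: gs); rewrite /= big_cons -/v -/s; split.
- by rewrite gX.
- move=> a; have := gsm a; rewrite /m' /set_mult; case: eqP => [->|//].
  by move=> use_le; rewrite -leq_subRL.
- by apply/andP; split; lra.
have -> : \sum_(0 <= h < D | (Y <= h)%N) w h * cos_weight (v :: map (gadget_value R) gs) h =
    \sum_(0 <= h < D | (Y <= h)%N) w' h * cos_weight (map (gadget_value R) gs) h.
  by apply: eq_bigr => h _; rewrite /cos_weight big_cons mulrA.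
have -> : expR (- (l%:R / 4 * (v + s))) = expR (- (l%:R / 4 * s)) * expR (- (l%:R / 4 * v)).
  by rewrite -expRD; congr expR; ring.
apply: le_trans gsw _; rewrite -[leRHS]mulrA; apply: ler_wpM2l; first exact: expR_ge0.
apply: le_trans gw _; apply: ler_wpM2r; first exact: sumr_ge0.
have := expR_ge1Dx (- (l%:R / 4 * v)); lra.
Qed.

Lemma double_sums_bounds (R : realType) (xs : seq R) (z : R) :
  (forall x, x \in xs -> 0 <= x) -> z \in double_sums xs -> 0 <= z <= 2 * \sum_(x <- xs) x.
Proof.
elim: xs z => [|x xs IH] z x0 /=.
  by rewrite inE => /eqP ->; rewrite big_nil mulr0 lexx.
have hx : 0 <= x by apply: x0; rewrite mem_head.
have {}IH w : w \in double_sums xs -> 0 <= w <= 2 * \sum_(y <- xs) y.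
  by apply: IH => y yxs; apply: x0; rewrite inE yxs orbT.
rewrite big_cons !mem_cat.
by case/or4P=> [/IH|/mapP[w /IH hw ->]|/mapP[w /IH hw ->]|/mapP[w /IH hw ->]];
  move=> *; lra.
Qed.

(** The total size [T = 1/16] makes the sum of the weights at most
    [D * expR (- (l / 64)) <= 1/4]. The greedy algorithm on the elements from [X0] on
    leaves an offset between 0 and [1 / X0], which the gadgets correct up to 1/N. *)
Lemma subsum_near_one (R : realType) (N l X X0 : nat) (K1 : R) (m : nat -> nat) :
  (1 < N)%N -> (8 <= l)%N -> (4 <= X0 <= X)%N ->
  4 * (2 * N ^ 2)%:R <= expR (l%:R / 64 : R) ->
  (forall m, (forall a, (a < X0)%N -> (m a < pdiv a)%N) -> K1 <= mass R X0 m ->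
     0 < large_mass R X0 (64 * l) m /\
     2 * nearly_divides_bound R X0 (2 * N ^ 2) l <= large_mass R X0 (64 * l) m) ->
  (forall a, (a < X)%N -> (m a < pdiv a)%N) ->
  K1 + 1 / 8 <= mass R X0 m ->
  1 <= mass R X (fun a => if (a < X0)%N then 0%N else m a) ->
  exists2 z : R, subsum X m z & 1 - 2 / N%:R <= z <= 1.
Proof.
move=> N1 l8 /andP[X4 X0X] hexp large hm lower tail.
set D := (2 * N ^ 2)%N in hexp large; set mt := fun a => _ in tail.
pose Y := (X0 %/ 4)%N; pose ml a := if (a < X0)%N then m a else 0%N.
have Y0 : (0 < Y)%N by rewrite divn_gt0.
have XY : (X0 <= 8 * Y)%N by rewrite /Y; lia.
have YX : (4 * Y <= X0)%N by rewrite /Y mulnC leq_divM.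
have D0 : (0 < D)%N by rewrite muln_gt0 expn_gt0 /=; lia.
have NR : 0 < N%:R :> R by rewrite ltr0n; lia.
have X0R : 0 < X0%:R :> R by rewrite ltr0n; lia.
have mlE : mass R X0 ml = mass R X0 m.
  by apply: eq_big_nat => a /andP[_ aX]; rewrite /ml aX.
have [||||gs] := @select_gadgets R l X0 Y D K1 ml (fun=> 1) (1 / 16) l8 XY large.
- by move=> a aX; rewrite /ml aX hm // (leq_trans aX).
- by [].
- by rewrite mlE; lra.
- by lra.
set xs := map _ gs; set s := \sum_(x <- xs) x => /= -[gsX gsm /andP[s1 s2] gsw].
have hW : \sum_(0 <= h < D | (Y <= h)%N) cos_weight xs h <= 1 / 4.
  under eq_bigr => h _ do rewrite -[cos_weight _ _]mul1r.
  apply: le_trans gsw _.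
  have sumD : \sum_(0 <= h < D | (Y <= h)%N) 1 <= D%:R :> R.
    apply: (@le_trans _ _ (\sum_(0 <= h < D) 1)).
      by rewrite big_mkcond; apply: ler_sum => h _; case: ifP.
    by rewrite big_const_nat iter_addr_0 subn0.
  apply: le_trans (ler_wpM2l (expR_ge0 _) sumD) _.
  rewrite expRN mulrC ler_pdivrMr ?expR_gt0 //.
  have : expR (l%:R / 64) <= expR (l%:R / 4 * s).
    by rewrite ler_expR; have : 0 <= l%:R :> R by []; nra.
  lra.
have Ninv : 1 / N%:R <= 1 / 2 :> R by rewrite !div1r lef_pV2 ?posrE // ler_nat.
have Ninv0 : 0 < 1 / N%:R :> R by rewrite divr_gt0.
have Xinv : X0%:R^-1 <= 1 / 4 :> R by rewrite div1r lef_pV2 ?posrE // ler_nat.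
pose t := 1 - 1 / N%:R - s.
have [|||k2 [k2m k2t1 k2t2]] := @greedy R X X0 mt t.
- by move=> a aX; rewrite /mt aX.
- exact: leq_trans X4.
- by rewrite /t; apply/andP; split; lra.
set tau := mass R X k2 in k2t1 k2t2; pose u := 1 - 1 / N%:R - tau.
have hu : 4 * Y%:R * `|s - u| <= 1.
  have us : `|s - u| <= X0%:R^-1 by rewrite ler_norml /u; apply/andP; split; rewrite /t in k2t1 k2t2; lra.
  apply: (@le_trans _ _ (X0%:R * X0%:R^-1)); last by rewrite divff // gt_eqF.
  by apply: ler_pM => //; [rewrite mulr_ge0 | rewrite -natrM ler_nat].
have [z zs hz] := double_sums_hit D0 Y0 hW hu.
have xs0 x : x \in xs -> 0 <= x by move=> /mapP[g _ ->]; rewrite divr_ge0.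
have /andP[z0 z2] := double_sums_bounds xs0 zs; rewrite -/s in z2.
have zu : `|z - u| <= 1 / N%:R.
  have b : 0 <= `|z - u| <= 1 / 2.
    by rewrite normr_ge0 ler_norml /u /=; rewrite /t in k2t1 k2t2; apply/andP; split; lra.
  have hs := sin_pi_ge b.
  have e : sin (pi * `|z - u|) ^+ 2 = sin (pi * (z - u)) ^+ 2.
    by case: (ger0P (z - u)) => _; rewrite ?mulrN ?sinN ?sqrrN.
  rewrite -(@ler_pXn2r _ 2) ?nnegrE //; last exact: ltW.
  apply: le_trans (_ : _ <= sin (pi * `|z - u|) ^+ 2) _.
    by rewrite !expr2; apply: ler_pM.
  rewrite e; apply: le_trans hz _; rewrite /D natrM natrX le_eqVlt; apply/orP; left; apply/eqP.
  by field; rewrite gt_eqF.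
have gsX' : all (fun g => g.1 < X)%N gs.
  by apply: sub_all gsX => g /= gX; apply: leq_trans gX X0X.
have [k1 k1m zE] := double_sums_mass gsX' zs.
exists (z + tau).
  exists (fun a => k1 a + k2 a)%N; last by rewrite mass_add zE.
  move=> a; have := leq_trans (k1m a) (gsm a); have := k2m a.
  rewrite /ml /mt; case: ifP => _; first by rewrite leqn0 => /eqP ->; rewrite addn0.
  by move=> k2a; rewrite leqn0 => /eqP ->.
by move: zu; rewrite ler_norml /u => /andP[h1 h2]; apply/andP; split; lra.
Qed.

(** * Harmonic sums and elements of small multiplicity *)

Lemma harmonic_sum_le (R : realType) (X : nat) :
  (0 < X)%N -> harmonic_sum R X <= 1 + ln X%:R.
Proof.
move=> X0; apply: (@le_trans _ _ (harmonic_sum R X.+1)).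
  by rewrite /harmonic_sum big_nat_recr //= lerDl invr_ge0.
case: X X0 => // X _; elim: X => [|X IH].
  by rewrite /harmonic_sum !big_nat_recr //= big_nil invr0 invr1 ln1 !add0r addr0.
rewrite /harmonic_sum big_nat_recr //= -/(harmonic_sum R X.+2).
apply: le_trans (lerD IH (lexx _)) _; rewrite -addrA lerD2l.
have p1 : 0 < X.+1%:R :> R by rewrite ltr0n.
have p2 : 0 < X.+2%:R :> R by rewrite ltr0n.
have i2 : X.+2%:R^-1 < 1 :> R by rewrite invf_lt1 // ltr1n.
have := @le_ln1Dx R (- X.+2%:R^-1); rewrite ltrN2 i2 => /(_ isT).
have -> : 1 - X.+2%:R^-1 = X.+1%:R / X.+2%:R :> R.
  have e2 : X.+2%:R = X.+1%:R + 1 :> R by rewrite natr1.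
  by rewrite e2; move: X.+1%:R p1 {IH p2 i2 e2} => y y0; field; lra.
rewrite ln_div ?posrE //.
by move: (ln X.+1%:R) (ln X.+2%:R) X.+2%:R^-1 => u v w; lra.
Qed.

Lemma harmonic_sum_ge (R : realType) (P : nat) :
  (0 < P)%N -> ln P%:R <= harmonic_sum R P.
Proof.
case: P => // P _; elim: P => [|P IH]; first by rewrite ln1 harmonic_sum_ge0.
rewrite /harmonic_sum big_nat_recr //= -/(harmonic_sum R P.+1).
apply: le_trans (lerD IH (lexx _)).
have p1 : 0 < P.+1%:R :> R by rewrite ltr0n.
have i1 : 0 < P.+1%:R^-1 :> R by rewrite invr_gt0.
have := @le_ln1Dx R P.+1%:R^-1; rewrite (lt_trans _ i1) ?ltrN10 // => /(_ isT).
have -> : 1 + P.+1%:R^-1 = P.+2%:R / P.+1%:R :> R.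
  have e2 : P.+2%:R = P.+1%:R + 1 :> R by rewrite natr1.
  by rewrite e2; move: P.+1%:R p1 {IH i1 e2} => y y0; field; lra.
rewrite ln_div ?posrE ?ltr0n //.
by move: (ln P.+1%:R) (ln P.+2%:R) P.+1%:R^-1 => u v w; lra.
Qed.

Definition rough_sum (R : realType) (P X : nat) : R :=
  \sum_(0 <= a < X | (P <= pdiv a)%N) a%:R^-1.
Arguments rough_sum : clear implicits.

Lemma rough_mul_inj (P b b' c c' : nat) :
  (P <= pdiv b)%N -> (P <= pdiv b')%N -> (0 < c < P)%N -> (0 < c' < P)%N ->
  (b * c = b' * c')%N -> b = b' /\ c = c'.
Proof.
move=> Pb Pb' /andP[c0 cP] /andP[c0' cP'] e.
pose pi := [pred p | p < P]%N : nat_pred.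
have pos x : (P <= pdiv x)%N -> (0 < x)%N.
  by case: x => // h; have : (P <= 1)%N by []; lia.
have rough x : (P <= pdiv x)%N -> pi^'.-nat x.
  move=> h; apply/pnatP; first exact: pos.
  move=> p p_pr px; rewrite !inE -leqNgt; apply: leq_trans h _.
  by apply: pdiv_min_dvd; rewrite ?prime_gt1.
have smooth x : (0 < x < P)%N -> pi.-nat x.
  move=> /andP[x0 xP]; apply/pnatP => // p p_pr px; rewrite inE /=.
  by apply: leq_ltn_trans xP; exact: dvdn_leq.
have sc := smooth c (introT andP (conj c0 cP)).
have sc' := smooth c' (introT andP (conj c0' cP')).
have part x y : (P <= pdiv x)%N -> (0 < y)%N -> pi.-nat y -> ((x * y)`_pi = y)%N.
  move=> Px y0 sy; rewrite partnM ?(pos x) // (part_pnat_id sy).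
  by rewrite (part_p'nat (rough x Px)) mul1n.
have cc : c = c' by rewrite -(part b c Pb c0 sc) e part.
by split=> //; move/eqP: e; rewrite -cc eqn_pmul2r // => /eqP.
Qed.

(** The products of an integer free of prime factors below [P] and a positive
    integer below [P] are pairwise distinct, as the two factors are the rough and
    the smooth part of the product. *)
Lemma rough_sum_harmonic (R : realType) (P X : nat) :
  rough_sum R P X * harmonic_sum R P <= harmonic_sum R (X * P).
Proof.
have [P0|P0] := posnP P.
  by rewrite P0 [harmonic_sum R 0]/harmonic_sum big_geq // mulr0 harmonic_sum_ge0.
pose B := [seq b <- index_iota 0 X | P <= pdiv b]%N.
pose s := [seq (b * c)%N | b <- B, c <- index_iota 1 P].
have -> : rough_sum R P X * harmonic_sum R P = \sum_(n <- s) n%:R^-1.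
  rewrite /s big_allpairs_dep /= /rough_sum /harmonic_sum -[X in X * _]big_filter -/B.
  rewrite big_ltn // invr0 add0r mulr_suml; apply: eq_bigr => b _.
  by rewrite mulr_sumr; apply: eq_bigr => c _; rewrite natrM invfM.
have us : uniq s.
  apply: allpairs_uniq; rewrite ?filter_uniq ?iota_uniq //.
  move=> [b c] [b' c'] /=.
  move=> /allpairsP[[x y] /= [xB yC [-> ->]]] /allpairsP[[x' y'] /= [xB' yC' [-> ->]]] e.
  move: xB yC xB' yC'; rewrite !mem_filter !mem_index_iota.
  move=> /andP[Px _] hy /andP[Px' _] hy'.
  by have [-> ->] := rough_mul_inj Px Px' hy hy' e.
have ps : perm_eq s [seq n <- index_iota 0 (X * P) | n \in s].
  apply: uniq_perm; rewrite ?filter_uniq ?iota_uniq // => n.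
  rewrite mem_filter; case: (boolP (n \in s)) => //= /allpairsP[[x y] /= [xB yC ->]].
  move: xB yC; rewrite mem_filter !mem_index_iota => /andP[_ xX] /andP[y0 yP].
  by rewrite ltn_mul.
rewrite (perm_big _ ps) big_filter /harmonic_sum big_mkcond /=.
by apply: ler_sum => n _; case: ifP => // _; rewrite invr_ge0.
Qed.

(** If [pdiv a < P], the multiplicity of [a] is below [P] and the harmonic sum suffices;
    otherwise [a] is one of the sparse integers counted by [rough_sum]. *)
Lemma small_mass_le (R : realType) (X P M : nat) (m : nat -> nat) :
  (forall a, (a < X)%N -> (m a < pdiv a)%N) ->
  \sum_(0 <= a < X | (m a < M)%N) (m a)%:R / a%:R <=
  P%:R * harmonic_sum R X + M%:R * rough_sum R P X.
Proof.
move=> hm; rewrite /harmonic_sum /rough_sum !mulr_sumr.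
rewrite [in leRHS]big_mkcond /= [X in _ <= _ + X]big_mkcond -big_split /= big_mkcond /=.
rewrite big_nat_cond [leRHS]big_nat_cond; apply: ler_sum => a /andP[/andP[_ aX] _].
have ai : 0 <= a%:R^-1 :> R by rewrite invr_ge0.
have pa : 0 <= P%:R * a%:R^-1 :> R by rewrite mulr_ge0.
have mma : 0 <= M%:R * a%:R^-1 :> R by rewrite mulr_ge0.
case: ifP => mM; last by rewrite addr_ge0 //; case: ifP.
case: leqP => Pa.
  apply: (@le_trans _ _ (M%:R / a%:R)); last by rewrite lerDr.
  by rewrite ler_wpM2r // ler_nat ltnW.
by rewrite addr0 ler_wpM2r // ler_nat ltnW // (ltn_trans (hm a aX)).
Qed.

Lemma large_mass_ge (R : realType) (l P X D : nat) (m : nat -> nat) :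
  (forall a, (a < X)%N -> (m a < pdiv a)%N) ->
  P%:R * harmonic_sum R X + (64 * l)%:R * rough_sum R P X + 2 * nearly_divides_bound R X D l + 1
    <= mass R X m ->
  0 < large_mass R X (64 * l) m /\ 2 * nearly_divides_bound R X D l <= large_mass R X (64 * l) m.
Proof.
move=> hm.
have -> : mass R X m = large_mass R X (64 * l) m +
    \sum_(0 <= a < X | (m a < 64 * l)%N) (m a)%:R / a%:R.
  rewrite /mass /large_mass (bigID (fun a => 64 * l <= m a)%N) /=; congr (_ + _).
  by apply: eq_bigl => a; rewrite ltnNge.
have := small_mass_le R P (64 * l) hm.
have : 0 <= nearly_divides_bound R X D l.
  by rewrite mulr_ge0 // addr_ge0 ?mulr_ge0 // harmonic_sum_ge0.
by move=> *; split; lra.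
Qed.

(** * The size of the required mass *)

(** The mass that the elements below [X] need in [select_gadgets], for [l = P ^ 2]:
    what is lost by discarding multiplicities below [64 * l], then twice the mass that
    can nearly divide a frequency.  A square for [l] makes [P] a convenient bound between
    small and large prime factors, as [ln P] is then comparable to [ln l]. *)
Definition threshold (R : realType) (N P X : nat) : R :=
  P%:R * harmonic_sum R X + (64 * P ^ 2)%:R * rough_sum R P X +
  2 * nearly_divides_bound R X (2 * N ^ 2) (P ^ 2) + 1.
Arguments threshold : clear implicits.

Lemma harmonic_sum_mono (R : realType) (X Y : nat) :
  (X <= Y)%N -> harmonic_sum R X <= harmonic_sum R Y.
Proof.
move=> XY; rewrite [leRHS](big_cat_nat _ XY) //= lerDl.
by apply: sumr_ge0 => b _; rewrite invr_ge0.
Qed.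

Lemma ln_le_nat (R : realType) (n : nat) : ln n%:R <= n%:R :> R.
Proof.
case: n => [|n]; first by rewrite ln0.
by apply/ltW/ln_sublinear; rewrite ltr0n.
Qed.

Lemma ln4_le (R : realType) : ln 4 <= 3 :> R.
Proof.
have := @le_ln1Dx R 3; rewrite (_ : 1 + 3 = 4 :> R); last by ring.
by apply; lra.
Qed.

(** With [l] of order [L], each of the terms is [O(L ^ 2 / ln P)]: the logarithm comes
    from [rough_sum_harmonic] in one term, and in another from the number of prime
    factors above [64 * l] of an integer up to [4 * N ^ 2]. *)
Lemma threshold_le (R : realType) (N P X : nat) (L := ln N%:R : R) :
  (1 < P)%N -> (0 < X <= N)%N -> 1 <= L -> P%:R ^+ 2 <= 700 * L ->
  ln P%:R * threshold R N P X <= 2000 * (1000 * L ^+ 2).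
Proof.
move=> P1 /andP[X0 XN] L1 PL; set p : R := ln P%:R.
have P0R : 1 < P%:R :> R by rewrite ltr1n.
have p0 : 0 < p by rewrite ln_gt0.
have pP : p <= P%:R by exact: ln_le_nat.
have N0R : 0 < N%:R :> R by rewrite ltr0n; apply: leq_trans XN.
set H := harmonic_sum R X.
have H0 : 0 <= H by exact: harmonic_sum_ge0.
have HL : H <= 1 + L.
  by apply: le_trans (harmonic_sum_mono R XN) _; apply: harmonic_sum_le; exact: leq_trans XN.
have PL2 : P%:R <= 27 * L by nra.
have t1 : p * (P%:R * H) <= 2 * (1000 * L ^+ 2).
  have h1 : p * P%:R <= P%:R ^+ 2 by rewrite expr2 ler_wpM2r // ltW.
  have h2 : H <= 2 * L by lra.
  rewrite mulrA; apply: le_trans (ler_pM _ H0 h1 h2) _; first by rewrite mulr_ge0 // ltW.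
  nra.
have t2 : p * rough_sum R P X <= 29 * L.
  have r0 : 0 <= rough_sum R P X by apply: sumr_ge0 => a _; rewrite invr_ge0.
  have h1 := ler_wpM2r r0 (harmonic_sum_ge R (ltnW P1)).
  apply: le_trans h1 _; rewrite mulrC; apply: le_trans (rough_sum_harmonic R P X) _.
  have h2 : (X * P <= N * P)%N by rewrite leq_mul2r XN orbT.
  apply: le_trans (harmonic_sum_mono R h2) _.
  apply: le_trans (harmonic_sum_le R _) _; first by rewrite muln_gt0 (leq_trans X0 XN) ltnW.
  by rewrite natrM lnM ?posrE ?(lt_trans _ P0R) // -/p -/L; lra.
have lE : (P ^ 2)%:R = P%:R ^+ 2 :> R by rewrite natrX.
have t3 : p * nearly_divides_bound R X (2 * N ^ 2) (P ^ 2) <= 30 * (1000 * L ^+ 2).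
  rewrite /nearly_divides_bound -/H lE; set k := trunc_log _ _.
  have kp : p * k%:R <= 5 * L.
    have M1 : (P <= 64 * P ^ 2)%N.
      apply: leq_trans (_ : P <= P * P)%N _; first by rewrite leq_pmulr // ltnW.
      by rewrite mulnn leq_pmull.
    have D0 : (0 < 2 * (2 * N ^ 2))%N by rewrite !muln_gt0 /= (leq_trans X0 XN).
    have Pk : (P ^ k <= 2 * (2 * N ^ 2))%N.
      apply: leq_trans (_ : P ^ k <= (64 * P ^ 2) ^ k)%N _; first by case: (k) => // j; rewrite leq_exp2r.
      apply: trunc_logP => //; exact: leq_trans M1.
    have : ln (P%:R ^+ k) <= ln ((2 * (2 * N ^ 2))%:R) :> R.
      rewrite ler_ln ?posrE ?ltr0n // -?natrX ?ler_nat // ltr0n expn_gt0; apply/orP; left.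
      exact: ltnW.
    rewrite lnXn ?(lt_trans _ P0R) // -/p mulnA (natrM _ 4 (N ^ 2)) natrX.
    rewrite lnM ?posrE ?exprn_gt0 // lnXn // -/L -[p *+ k]mulr_natr -[L *+ 2]mulr_natr.
    have := ln4_le R; lra.
  rewrite mulrA.
  have h1 : 0 <= p * k%:R by rewrite mulr_ge0 // ltW.
  have h2 : 4 * P%:R ^+ 2 + 5 * H <= 2820 * L by lra.
  have h3 : 0 <= 4 * P%:R ^+ 2 + 5 * H by rewrite addr_ge0 // mulr_ge0 // exprn_ge0.
  apply: le_trans (ler_pM h1 h3 kp h2) _; nra.
have t4 : p * ((64 * P ^ 2)%:R * rough_sum R P X) <= 1300 * (1000 * L ^+ 2).
  rewrite mulrCA natrM lE.
  have r0 : 0 <= p * rough_sum R P X.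
    by apply: mulr_ge0; [exact: ltW | apply: sumr_ge0 => a _; rewrite invr_ge0].
  have h1 : 64 * P%:R ^+ 2 <= 64 * (700 * L) by lra.
  have h2 : 0 <= 64 * P%:R ^+ 2 :> R by rewrite mulr_ge0 // exprn_ge0.
  apply: le_trans (ler_pM h2 r0 h1 t2) _; nra.
have t5 : p <= 1000 * L ^+ 2 by apply: le_trans pP _; nra.
rewrite /threshold -/H !mulrDr mulr1 [p * (2 * _)]mulrCA.
by move: (1000 * L ^+ 2) t1 t3 t4 t5 => Q t1 t3 t4 t5; lra.
Qed.

(** * Existence of a subsum close to 1 *)

Lemma mass_split (R : realType) (X x : nat) (m : nat -> nat) : (x <= X)%N ->
  mass R X m = mass R x m + mass R X (fun a => if (a < x)%N then 0%N else m a).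
Proof.
move=> xX; rewrite /mass (big_cat_nat _ xX) //=; congr (_ + _).
rewrite [RHS](big_cat_nat _ xX) //= [X in _ = X + _](_ : _ = 0).
  by rewrite add0r; apply: eq_big_nat => a /andP[xa _]; rewrite ltnNge xa.
by rewrite big_nat_cond big1 // => a /andP[/andP[_ ax] _]; rewrite ax mul0r.
Qed.

Lemma subsum_exists (R : realType) (N P X : nat) (K : R) (m : nat -> nat) :
  (1 < N)%N -> (2 < P)%N -> (1 < X)%N -> 4 * (2 * N ^ 2)%:R <= expR ((P ^ 2)%:R / 64 : R) ->
  (forall x, (0 < x <= N)%N -> threshold R N P x + 3 <= K) ->
  3 <= K -> m 0%N = 0%N -> K < mass R X m ->
  exists2 z : R, subsum X m z & 1 - 2 / N%:R <= z <= 1.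
Proof.
move=> N1 P2 X1 hexp hK K3 m0 Km.
have [m' [m'0 massE msub mlt]] := merge_copies R X m0.
suff [z zs hz] : exists2 z : R, subsum X m' z & 1 - 2 / N%:R <= z <= 1.
  by exists z => //; exact: msub.
rewrite -massE in Km; move: m' m'0 Km mlt {msub massE m m0} => m m0 Km mlt.
have NR : 0 < N%:R :> R by rewrite ltr0n ltnW.
have N20 : 0 <= 2 / N%:R :> R by rewrite divr_ge0 // ltW.
have [m1|m1] := posnP (m 1%N); last first.
  exists 1; last by rewrite lexx andbT lerBlDr lerDl.
  exists (set_mult (fun=> 0%N) 1 1); first by move=> a; rewrite /set_mult; case: eqP => [->|].
  by rewrite mass_set_mult // mass0 mul0r subr0 add0r divr1.
have hm a : (a < X)%N -> (m a < pdiv a)%N.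
  by case: a => [|[|a]] aX; [rewrite m0 | rewrite m1 | exact: mlt].
pose mt x a := if (a < x)%N then 0%N else m a.
have mtm x a : (mt x a <= m a)%N by rewrite /mt; case: ifP.
have ex1 : exists x, 1 <= mass R X (mt x).
  exists 0%N; apply: le_trans (ltW Km); lra.
have bnd x : 1 <= mass R X (mt x) -> (x <= X)%N.
  move=> h; rewrite leqNgt; apply/negP => Xx; move: h.
  rewrite /mass big_nat_cond big1 ?ler10 // => a /andP[/andP[_ aX] _].
  by rewrite /mt (ltn_trans aX Xx) mul0r.
(* [mt x] keeps the elements that are at least [x]. *)
have [X0 tX0 X0max] := ex_maxnP ex1 bnd.
have X0X := bnd _ tX0.
have X0_gt0 : (0 < X0)%N.
  apply: X0max; apply: le_trans (_ : mass R X m <= _); first by lra.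
  apply: ler_sum => a _; apply: ler_wpM2r; first by rewrite invr_ge0.
  by rewrite ler_nat /mt; case: a => // ; rewrite m0.
have X0R : 0 < X0%:R :> R by rewrite ltr0n.
have [NX|XN] := leqP N X0.
  have [||| k [km k1 k2]] := @greedy R X X0 (mt X0) 1.
  - by move=> a aX; rewrite /mt aX.
  - by [].
  - by rewrite ler01.
  exists (mass R X k); first by exists k => // a; exact: leq_trans (km a) (mtm X0 a).
  rewrite k2 andbT; apply: le_trans (ltW k1); rewrite lerD2l lerN2.
  apply: (@le_trans _ _ N%:R^-1); first by rewrite lef_pV2 ?posrE // ler_nat.
  by rewrite ler_peMl ?invr_ge0 ?ltW // ltr1n.
have X0X' : (X0 < X)%N.
  rewrite ltn_neqAle X0X andbT; apply/eqP => E; move: tX0.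
  rewrite /mass big_nat_cond big1 ?ler10 // => a /andP[/andP[_ aX] _].
  by rewrite /mt E aX mul0r.
have tail_lt : mass R X (mt X0.+1) < 1.
  by rewrite ltNge; apply/negP => /X0max; rewrite ltnn.
have mX0 : (m X0)%:R / X0%:R <= 1 :> R.
  rewrite ler_pdivrMr // mul1r ler_nat; apply: leq_trans (ltnW (hm _ X0X')) _.
  by apply: dvdn_leq => //; exact: pdiv_dvd.
have massX0 : K - 2 < mass R X0 m.
  have e1 := mass_split R m X0X'; rewrite {2}/mass big_nat_recr //= -/(mass R X0 m) in e1.
  rewrite -/(mt X0.+1) in e1; lra.
(* Otherwise 2 is the only element below [X0], and it occurs at most once. *)
have X04 : (4 <= X0)%N.
  rewrite leqNgt; apply/negP => X0lt; move: massX0; apply/negP; rewrite -leNgt.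
  case: X0 X0X' X0lt {tX0 X0max X0X X0_gt0 X0R XN tail_lt mX0} => [|[|[|[|]]]] // X0X' _;
    rewrite /mass ?big_nat_recr //= big_geq // ?m0 ?m1 ?mul0r ?add0r; try lra.
  have m2 : (m 2)%:R <= 1 :> R.
    by rewrite (ler_nat R _ 1); have := hm 2 (ltn_trans (ltnSn 2) X0X').
  lra.
apply: (@subsum_near_one R N (P ^ 2) X X0 (threshold R N P X0)) => //.
- by rewrite -mulnn; apply: leq_trans (leq_mul P2 P2).
- by rewrite X04 ltnW.
- by move=> m2 hm2 thr; apply: (@large_mass_ge R (P ^ 2) P X0 _ m2 hm2).
- have := hK X0; rewrite X0_gt0 ltnW // => /(_ isT); lra.
Qed.

Lemma mass_count (R : realType) (X : nat) (s : seq nat) :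
  all (fun a => a < X)%N s -> \sum_(a <- s) a%:R^-1 = mass R X (fun a => count_mem a s).
Proof.
elim: s => [|b s IH] /=; first by rewrite big_nil mass0.
move=> /andP[bX sX]; rewrite big_cons IH // mass_add; congr (_ + _).
rewrite /mass (bigD1_seq b) ?iota_uniq ?mem_index_iota //= eqxx mul1r big1 ?addr0 //.
by move=> a /negbTE ab; rewrite eq_sym ab mul0r.
Qed.

(** Back to finite multisets: the multiplicity function [k] is realised by repeating
    each [a] exactly [k a] times. *)
Lemma subsum_mset (R : realType) (X : nat) (A : {mset nat}%mset) (z : R) :
  subsum X A z -> exists2 T : {mset nat}%mset, (T `<=` A)%mset & recip_sum R T = z.
Proof.
move=> [k kA ->]; pose s := flatten [seq nseq (k a) a | a <- index_iota 0 X].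
exists (seq_mset s).
  apply/msubsetP => a; rewrite mset_seqE; apply: leq_trans (kA a).
  rewrite /s count_flatten -map_comp sumnE big_map.
  rewrite (eq_bigr (fun b => if b == a then k b else 0)%N); last first.
    by move=> b _ /=; rewrite count_nseq /=; case: eqP => _; rewrite ?mul1n ?mul0n.
  rewrite -big_mkcond -big_filter.
  have [aX|Xa] := ltnP a X.
    by rewrite filter_pred1_uniq ?iota_uniq ?mem_index_iota // big_seq1.
  rewrite big_filter big_nat_cond big1 // => b /andP[/andP[_ bX] /eqP ab].
  by move: bX; rewrite ab ltnNge Xa.
rewrite /recip_sum (perm_big _ (perm_eq_seq_mset s)) /= /s big_flatten /= big_map.
apply: eq_bigr => a _; rewrite big_nseq iter_addr_0 mulr_natl //.
Qed.

Lemma recip_defect_le (R : realType) (X : nat) (A : {mset nat}%mset) (z : R) :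
  subsum X A z -> z <= 1 -> recip_defect R A <= 1 - z.
Proof.
move=> /subsum_mset[T TA <-] T1; have [S [_ _ -> maxS]] := recip_defect_max R A.
by rewrite lerD2l lerN2 maxS.
Qed.

Lemma recip_sum_mass (R : realType) (A : {mset nat}%mset) :
  exists2 X, (1 < X)%N & recip_sum R A = mass R X A.
Proof.
exists (\max_(a <- A) a).+2 => //.
rewrite /recip_sum (@mass_count R (\max_(a <- A) a).+2).
  by apply: eq_bigr => a _; rewrite count_mem_mset.
apply/allP => a aA; rewrite ltnS ltnW // ltnS; exact: leq_bigmax_seq.
Qed.

Lemma exists_nat_between (R : realType) (x : R) :
  0 <= x -> exists2 n : nat, x < n%:R & n%:R <= x + 1.
Proof.
move=> x0; exists (Num.truncn x).+1.
  exact: Num.Theory.truncnS_gt.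
by rewrite -natr1 lerD2r Num.Theory.truncn_le.
Qed.

(** * Choice of the parameters and conclusion *)

Lemma ln_ge1Vx (R : realType) (x : R) : 0 < x -> 1 - x^-1 <= ln x.
Proof.
move=> x0; have xi : 0 < x^-1 by rewrite invr_gt0.
have := @le_ln1Dx R (x^-1 - 1); have -> : 1 + (x^-1 - 1) = x^-1 by ring.
by rewrite lnV ?posrE // => h; have {}h := h ltac:(lra); lra.
Qed.

(** [N] is just above [2 * expR x] with [x = sqrt (K * ln K) / d], so [L] lies between
    [x] and [2 * x], while [P ^ 2] is of order [L].  Since [L] is at least the fourth root
    of [K], [ln K <= 8 * ln P], and [threshold_le] bounds the threshold by a constant times
    [x ^ 2 / ln K = K / d ^ 2]. *)
Lemma threshold_parameters (R : realType) (d K : R) :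
  200 * 100 <= d -> d ^+ 4 <= K ->
  exists N P : nat,
  [/\ (1 < N)%N, (2 < P)%N, 4 * (2 * N ^ 2)%:R <= expR ((P ^ 2)%:R / 64 : R),
      forall x, (0 < x <= N)%N -> threshold R N P x + 3 <= K &
      2 / N%:R <= expR (- d^-1 * Num.sqrt (K * ln K))].
Proof.
move=> d_big dK; have d100 : 100 <= d by lra.
have d0 : 0 < d by lra.
have d2 : 100 * d <= d ^+ 2 by rewrite expr2 ler_wpM2r // ltW.
have K_big : 100 <= K by apply: le_trans dK; rewrite (exprM _ 2 2) [X in _ <= X]expr2; nra.
have K0 : 0 < K by lra.
have lnK1 : 1 <= ln K.
  apply: (@le_trans _ _ (ln (d ^+ 4))); last by rewrite ler_ln ?posrE ?exprn_gt0.
  have := ln_ge1Vx d0; rewrite lnXn // -[X in _ -> _ <= X]mulr_natr.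
  have : d^-1 <= 1 / 100 by rewrite div1r lef_pV2 ?posrE.
  by move: (d^-1) => i; lra.
set S := Num.sqrt (K * ln K).
have S2 : S ^+ 2 = K * ln K by rewrite sqr_sqrtr // mulr_ge0 //; lra.
have S0 : 0 <= S by exact: sqrtr_ge0.
pose x := d^-1 * S; have xS : S = d * x by rewrite /x mulVKf // gt_eqF.
have x2 : d ^+ 2 * x ^+ 2 = K * ln K by rewrite -exprMn -xS.
have x0 : 0 <= x by rewrite mulr_ge0 // invr_ge0 ltW.
have KlK : K <= K * ln K by rewrite ler_peMr // ltW.
have xd : d <= x.
  have : d ^+ 2 * d ^+ 2 <= d ^+ 2 * x ^+ 2 by rewrite x2 -exprD (le_trans dK).
  by rewrite ler_pM2l ?exprn_gt0 // ler_pXn2r ?nnegrE // ltW.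
set E := expR x.
have E1 : 1 <= E by have := expR_ge1Dx x; rewrite -/E; lra.
have [N EN NE] : exists2 n : nat, 2 * E < n%:R & n%:R <= 2 * E + 1.
  by apply: exists_nat_between; lra.
have NR : 0 < N%:R :> R by lra.
have N0 : (0 < N)%N by rewrite -(ltr0n R).
set L := ln N%:R : R.
have xL : x <= L.
  by rewrite -[x]expRK ler_ln ?posrE ?expR_gt0 // -/E; lra.
have Lx : L <= 2 * x.
  apply: (@le_trans _ _ (ln (4 * E))); first by rewrite ler_ln ?posrE //; lra.
  rewrite lnM ?posrE ?expR_gt0 // expRK; have := ln4_le R; lra.
(* [ln 4 + ln 4] bounds [ln 8], so that [expR (q / 64)] is at least [8 * N ^ 2]. *)
pose q := 64 * (ln 4 + ln 4 + 2 * L).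
have l4 := ln4_le R; have l4' : 0 <= ln 4 :> R by rewrite ln_ge0; lra.
have q0 : 0 <= q by rewrite /q; lra.
have [P qP Pq] : exists2 n : nat, Num.sqrt q < n%:R & n%:R <= Num.sqrt q + 1.
  by apply: exists_nat_between; exact: sqrtr_ge0.
have sq0 := sqrtr_ge0 q; have sq2 := sqr_sqrtr q0.
move: (Num.sqrt q) sq0 sq2 qP Pq => r r0 rq rP Pr.
have P2q : q <= P%:R ^+ 2 by rewrite -rq; nra.
have P2L : P%:R ^+ 2 <= 700 * L.
  have : P%:R ^+ 2 <= 2 * q + 2.
    apply: (@le_trans _ _ ((r + 1) ^+ 2)).
      by rewrite lerXn2r ?nnegrE ?addr_ge0.
    by have := sqr_ge0 (r - 1); rewrite -rq; lra.
  rewrite /q; lra.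
have P2 : 2 < P%:R :> R.
  have q128 : 128 <= q by rewrite /q; lra.
  have P0 : 0 <= P%:R :> R by [].
  rewrite ltNge; apply/negP => P2; move: P2q; apply/negP; rewrite -ltNge expr2.
  by apply: le_lt_trans (ler_pM P0 P0 P2 P2) _; lra.
exists N, P; split.
- by rewrite -(ltr_nat R); lra.
- by rewrite -(ltr_nat R).
- rewrite -[leLHS]lnK; last by rewrite posrE mulr_gt0 // ltr0n !muln_gt0 /= N0.
  rewrite ler_expR (natrM _ 2) mulrA natrX lnM ?posrE ?exprn_gt0 //; last by lra.
  rewrite lnXn // -/L -[L *+ 2]mulr_natl natrX.
  have : ln (4 * 2) <= ln 4 + ln 4 :> R.
    by rewrite -lnM ?posrE // ler_ln ?posrE; lra.
  rewrite /q in P2q; lra.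
- move=> X0 hX0; rewrite -lerBrDr leNgt; apply/negP => big.
  have lnP : ln K <= 8 * ln P%:R.
    have h1 : ln L <= 2 * ln P%:R.
      rewrite mulr_natl -lnXn; last by lra.
      rewrite ler_ln ?posrE ?exprn_gt0; [|by lra..].
      by rewrite /q in P2q; lra.
    have h2 : ln K <= 4 * ln L.
      rewrite mulr_natl -lnXn; last by lra.
      rewrite ler_ln ?posrE ?exprn_gt0; [|by lra..].
      apply: (@le_trans _ _ (x ^+ 4)); last by rewrite lerXn2r ?nnegrE //; lra.
      rewrite -(ler_pM2l (exprn_gt0 4 d0)).
      have -> : d ^+ 4 * x ^+ 4 = (d ^+ 2 * x ^+ 2) ^+ 2 by ring.
      rewrite x2 expr2; apply: ler_pM => //; [by rewrite exprn_ge0 ?ltW | exact: ltW | exact: le_trans dK _].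
    lra.
  have P1 : (1 < P)%N by rewrite -(ltr_nat R); lra.
  have L1 : 1 <= L by lra.
  have := threshold_le P1 hX0 L1 P2L; apply/negP; rewrite -ltNge.
  have thr2 : K / 2 < threshold R N P X0 by lra.
  have lo : K * ln K / 16 < ln P%:R * threshold R N P X0.
    have lp : 0 < ln P%:R :> R by lra.
    apply: (@le_lt_trans _ _ (ln P%:R * (K / 2))); last by rewrite ltr_pM2l.
    rewrite [X in X <= _](_ : _ = (ln K / 8) * (K / 2)); last by field.
    by apply: ler_wpM2r; lra.
  apply: le_lt_trans lo.
  have L2 : L ^+ 2 <= 4 * x ^+ 2.
    have -> : 4 * x ^+ 2 = (2 * x) ^+ 2 by ring.
    by rewrite lerXn2r ?nnegrE //; lra.
  have dd : (200 * 100) * (200 * 100) <= d ^+ 2 by rewrite expr2; apply: ler_pM; lra.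
  have dx := ler_wpM2r (sqr_ge0 x) dd.
  rewrite -x2; move: (d ^+ 2 * x ^+ 2) (x ^+ 2) (L ^+ 2) dx L2 (sqr_ge0 x) => B Q LL dx L2 Q0.
  by lra.
rewrite mulNr -/x expRN -/E ler_pdivrMr // mulrC ler_pdivlMr ?expR_gt0 //.
exact: ltW.
Qed.

Theorem theorem1p1 (R : realType) :
  exists (c K0 : R), 0 < c /\
    forall (K : R) (A : {mset nat}%mset),
      K0 <= K ->
      (forall a : nat, a \in A -> (0 < a)%N) ->
      K < recip_sum R A ->
      recip_defect R A <= expR (- c * Num.sqrt (K * ln K)).
Proof.
pose d : R := 200 * 100.
exists d^-1, (d ^+ 4); split; first by rewrite invr_gt0 /d; lra.
move=> K A dK A0 KA.
have [N [P [N1 P2 hexp hK hN]]] := threshold_parameters (lexx d) dK.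
have [X X1 AE] := recip_sum_mass R A.
have K3 : 3 <= K by apply: le_trans dK; rewrite /d (exprM _ 2 2) !expr2; lra.
have m0 : A 0%N = 0%N by apply/mset_eq0P/negP => /A0.
rewrite AE in KA.
have [z zA /andP[z1 z2]] := subsum_exists N1 P2 X1 hexp hK K3 m0 KA.
apply: le_trans (recip_defect_le zA z2) _; apply: le_trans hN.
by move: (2 / N%:R) z1 => y z1; lra.
Qed.
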